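(* Let $X$ be a uniform space and $G$ a nontrivial internal abelian group. If $\tilde H_0(X;G)=0$, then $X$ is chain-connected.
   Context: Nonstandard setting: fix a standard universe $\mathbb{U}$ satisfying sufficiently many axioms of ZFC and containing all standard objects considered (uniform spaces are standard), and an elementary extension ${}^{\ast}\mathbb{U}$ of $\mathbb{U}$ (the internal universe) that is $|\mathbb{U}|^{+}$-saturated; $x\mapsto{}^{\ast}x$ is the elementary embedding. ''Internal'' means belonging to ${}^{\ast}\mathbb{U}$; ''hyperfinite'' means finite in the sense of ${}^{\ast}\mathbb{U}$. For a uniform space $X$, points $x,y\in{}^{\ast}X$ are infinitely close, $x\approx y$, if $(x,y)\in{}^{\ast}U$ for every entourage $U$ of $X$. $\mu$-chains: $C_p(X;G)$ is the internal abelian group of hyperfinite formal sums $\sum_{i=0}^{n}g_i\sigma_i$ with $\{g_i\}_{i=0}^n$ and $\{\sigma_i\}_{i=0}^n$ internal hyperfinite sequences in $G$ and in ${}^{\ast}X^{p+1}$ respectively (equivalently, internal functions ${}^{\ast}X^{p+1}\to G$ with hyperfinite support). A $p$-microsimplex is $(a_0,\ldots,a_p)\in{}^{\ast}X^{p+1}$ with $a_i\approx a_j$ for all $i,j\le p$. $M_p(X;G)\subseteq C_p(X;G)$ is the subgroup of $p$-microchains, i.e. elements representable as $\sum_{i=0}^n g_i\sigma_i$ with $\{g_i\}$, $\{\sigma_i\}$ internal hyperfinite sequences and every $\sigma_i$ a $p$-microsimplex. The boundary $\partial_p:M_p(X;G)\to M_{p-1}(X;G)$ is the restriction of the internal homomorphism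 determined by $\partial_p(a_0,\ldots,a_p)=\sum_{i=0}^p(-1)^i(a_0,\ldots,\hat a_i,\ldots,a_p)$. Reduced $\mu$-homology $\tilde H_\bullet(X;G)$ is the homology of the augmented complex $G\xleftarrow{\varepsilon}M_0(X;G)\xleftarrow{\partial_1}M_1(X;G)\xleftarrow{\partial_2}\cdots$, where $\varepsilon\left(\sum_i g_i\sigma_i\right)=\sum_i g_i$; so $\tilde H_0(X;G)=\ker\varepsilon/\mathrm{im}\,\partial_1$. A uniform space $X$ is chain-connected if for every entourage $U$ of $X$ and all $x,y\in X$ there is a finite sequence $x_0,\ldots,x_n$ in $X$ with $x_0=x$, $x_n=y$ and $(x_i,x_{i+1})\in U$ for all $i<n$. *)

(* Defs.v *)
From HB Require Import structures.
From mathcomp Require Import all_boot all_order all_algebra.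
From mathcomp Require Import all_classical.
From mathcomp Require Import topology_structure uniform_structure.

Set Implicit Arguments.
Unset Strict Implicit.
Unset Printing Implicit Defensive.

Import GRing.Theory.
Local Open Scope classical_set_scope.
Local Open Scope ring_scope.

(** * First-order structures in the language of set theory *)

Record set_structure := SetStructure {
  obj :> Type;
  elt : obj -> obj -> Prop   (* [elt x y] is "x belongs to y" *)
}.

(* First-order formulas in the signature {membership, equality}, with
   variables named by natural numbers. *)
Inductive formula :=
| FElt of nat & nat
| FEq of nat & nat
| FNot of formula
| FAnd of formula & formula
| FAll of nat & formula.

Definition upd (M : Type) (env : nat -> M) (v : nat) (a : M) : nat -> M :=
  fun w => if w == v then a else env w.

Fixpoint sat (M : set_structure) (env : nat -> M) (phi : formula) : Prop :=
  match phi with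
  | FElt v w => elt (env v) (env w)
  | FEq v w => env v = env w
  | FNot psi => ~ sat env psi
  | FAnd psi1 psi2 => sat env psi1 /\ sat env psi2
  | FAll v psi => forall a : M, sat (upd env v a) psi
  end.

Section SetNotions.
Variable M : set_structure.
Implicit Types x y z a b p : M.

Definition is_empty x := forall z, ~ elt z x.
Definition is_upair p a b := forall z, elt z p <-> z = a \/ z = b.
(* Kuratowski pairs. *)
Definition is_pair p a b :=
  forall z, elt z p <-> is_upair z a a \/ is_upair z a b.
Definition is_succ y x := forall z, elt z y <-> elt z x \/ z = x.
Definition inductive_set x :=
  (exists2 e, is_empty e & elt e x) /\
  (forall y z, elt y x -> is_succ z y -> elt z x).
(* Von Neumann naturals in the sense of [M]; the elements of such an [n] are
   the naturals smaller than [n]. *)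
Definition is_nat x := forall y, inductive_set y -> elt x y.

(* Code of a finite list of objects: nested pairs ending with the empty set. *)
Fixpoint is_list (s : seq M) p : Prop :=
  if s is a :: s' then exists2 q, is_list s' q & is_pair p a q
  else is_empty p.

End SetNotions.

(** * The standard universe *)

(* The axioms of set theory that are used: Zermelo's axioms with foundation.
   Separation is required for arbitrary predicates, so that every subset of a
   standard set is a standard object; the axiom of choice then follows from
   choice in the ambient logic.  All V_lambda, lambda > omega limit, qualify;
   replacement is not required. *)
Record standard_universe (U : set_structure) : Prop := StandardUniverse {
  su_extensionality : forall x y : U, (forall z, elt z x <-> elt z y) -> x = y;
  su_foundation : forall x : U, (exists y, elt y x) ->
    exists2 y, elt y x & forall z, elt z y -> ~ elt z x;
  su_pairing : forall a b : U, exists p, is_upair p a b;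
  su_union : forall x : U, exists y, forall z,
    elt z y <-> exists2 t, elt t x & elt z t;
  su_powerset : forall x : U, exists y, forall z,
    elt z y <-> forall t, elt t z -> elt t x;
  su_separation : forall (x : U) (P : U -> Prop), exists y, forall z,
    elt z y <-> elt z x /\ P z;
  su_infinity : exists x : U, inductive_set x
}.

(** * The internal universe *)

(* |U|^+-saturation: a set of at most |U| formulas in the variable 0, with
   parameters from the extension, is realized as soon as it is finitely
   satisfiable.  A formula with parameters is a formula together with an
   environment; as the language is countable and U infinite, sets of at most
   |U| such formulas are the families indexed by U. *)
Definition saturated_over (U : Type) (V : set_structure) : Prop :=
  forall Phi : U -> formula * (nat -> V),
    (forall (n : nat) (k : 'I_n -> U), exists a : V, forall i : 'I_n,
       sat (upd (Phi (k i)).2 0 a) (Phi (k i)).1) ->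
    exists a : V, forall u : U, sat (upd (Phi u).2 0 a) (Phi u).1.

Record nonstandard_extension (U : set_structure) := NonstandardExtension {
  internal :> set_structure;
  star : U -> internal;
  star_elementary : forall (phi : formula) (env : nat -> U),
    sat env phi <-> sat (fun v => star (env v)) phi;
  star_saturated : saturated_over U internal
}.

(** * Standard uniform spaces *)

(* A uniform space belonging to the universe: its points are (coded by) the
   elements of a set of the universe. *)
Record standard_space (U : set_structure) := StandardSpace {
  space :> uniformType;
  point_code : space -> U;
  point_code_inj : injective point_code;
  space_code : U;
  space_codeP : forall u : U,
    elt u space_code <-> exists x : space, point_code x = u
}.

Definition relation_code (U : set_structure) (X : standard_space U)
    (E : set (X * X)) (e : U) : Prop :=
  forall p : U, elt p e <->
    exists x y : X, E (x, y) /\ is_pair p (point_code x) (point_code y).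

Definition chain_connected (X : uniformType) : Prop :=
  forall E : set (X * X), entourage E -> forall x y : X,
    exists (n : nat) (s : nat -> X),
      [/\ s 0 = x, s n = y & forall i, (i < n)%N -> E (s i, s i.+1)].

(** * Internal objects *)

(* A type each of whose elements is represented by objects of [V]. *)
Record coded_type (V : set_structure) := CodedType {
  csort :> Type;
  codes : csort -> V -> Prop
}.

Definition elements (V : set_structure) (a : V) : coded_type V :=
  @CodedType V {x : V | elt x a} (fun t x => x = sval t).

Definition naturals (V : set_structure) : coded_type V :=
  @CodedType V {x : V | is_nat x} (fun t x => x = sval t).

(* [f] is internal when its graph is a set of [V]. *)
Definition internal_fun (V : set_structure) (A B : coded_type V)
    (f : A -> B) : Prop :=
  exists F : V, forall p : V, elt p F <->
    exists (t : A) (x y : V), [/\ codes t x, codes (f t) y & is_pair p x y].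

(* An abelian group whose carrier is a set of [V] and whose addition belongs
   to [V]. *)
Record internal_zmod (V : set_structure) := InternalZmod {
  zsort :> zmodType;
  zcode : zsort -> V;
  zcode_inj : injective zcode;
  zset : V;
  zsetP : forall u : V, elt u zset <-> exists g : zsort, zcode g = u;
  zadd_internal : exists F : V, forall q : V, elt q F <->
    exists (g h : zsort) (p : V),
      is_pair p (zcode g) (zcode h) /\ is_pair q p (zcode (g + h))
}.

Definition zcoded (V : set_structure) (G : internal_zmod V) : coded_type V :=
  @CodedType V G (fun g x => x = zcode g).

(** * Hyperfinite sums *)

Section HyperfiniteSums.
Variables (V : set_structure) (G : internal_zmod V).

(* [v] is the sum of [h i] over the hypernaturals [i < n]: it is the [n]-th
   term of the internal sequence [s] of the partial sums. *)
Definition seq_sum (n : naturals V) (h : elements (sval n) -> G) (v : G) :=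
  exists s : naturals V -> G,
    [/\ @internal_fun V (naturals V) (zcoded G) s,
        forall z : naturals V, is_empty (sval z) -> s z = 0,
        forall (i : elements (sval n)) (j k : naturals V),
          sval j = sval i -> is_succ (sval k) (sval j) -> s k = s j + h i
      & s n = v].

(* The sum of the values of [c], computed along an internal enumeration
   without repetition of a hyperfinite set containing the support of [c]. *)
Definition is_hsum (A : coded_type V) (c : A -> G) (v : G) :=
  exists (n : naturals V) (e : elements (sval n) -> A),
    [/\ @internal_fun V (elements (sval n)) A e,
        injective e,
        forall a : A, c a <> 0 -> exists i, e i = a
      & seq_sum (fun i => c (e i)) v].

(* Meaningful for internal [c] with hyperfinite support. *)
Definition hsum (A : coded_type V) (c : A -> G) : G :=
  xget 0 [set v | is_hsum c v].

End HyperfiniteSums.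

(** * Microchains and reduced mu-homology *)

Section MuHomology.
Variables (U : set_structure) (V : nonstandard_extension U).
Variables (X : standard_space U) (G : internal_zmod V).

Definition starX : coded_type V := elements (star V (space_code X)).

Definition infinitely_close (a b : starX) : Prop :=
  forall E : set (X * X), entourage E ->
    exists (e : U) (p : V),
      [/\ relation_code E e, is_pair p (sval a) (sval b) & elt p (star V e)].

Definition simplex (p : nat) : coded_type V :=
  @CodedType V (p.+1.-tuple starX)
    (fun sigma x => is_list [seq sval a | a <- sigma] x).

Definition microsimplex (p : nat) (sigma : simplex p) : Prop :=
  forall i j : 'I_p.+1, infinitely_close (tnth sigma i) (tnth sigma j).

(* A chain is identified with the function giving its coefficients. *)
Definition chain (p : nat) : Type := simplex p -> G.

(* sum_(i < n) g_i sigma_i *)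
Definition formal_sum (p : nat) (n : naturals V)
    (g : elements (sval n) -> G) (sigma : elements (sval n) -> simplex p) :
    chain p :=
  fun tau => hsum (A := elements (sval n))
    (fun i => if `[< sigma i = tau >] then g i else 0).

Definition microchain (p : nat) : set (chain p) :=
  [set c | exists (n : naturals V) (g : elements (sval n) -> G)
                  (sigma : elements (sval n) -> simplex p),
     [/\ @internal_fun V (elements (sval n)) (zcoded G) g,
         @internal_fun V (elements (sval n)) (simplex p) sigma,
         forall i, microsimplex (sigma i)
       & c = formal_sum g sigma]].

Definition face (p : nat) (j : 'I_p.+2) (sigma : simplex p.+1) : simplex p :=
  [tuple tnth sigma (lift j i) | i < p.+1].

(* The linear extension of sigma |-> sum_j (-1)^j face j sigma: the
   coefficient at tau is the sum over j of (-1)^j times the (hyperfinite) sum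
   of the c(sigma) over the sigma whose j-th face is tau. *)
Definition boundary (p : nat) (c : chain p.+1) : chain p :=
  fun tau => \sum_(j < p.+2)
    hsum (A := simplex p.+1)
      (fun sigma => if `[< face j sigma = tau >] then c sigma else 0)
    *~ (-1) ^+ j.

Definition augmentation (c : chain 0) : G := hsum (A := simplex 0) c.

Definition reduced_cycles (p : nat) : set (chain p) :=
  match p with
  | 0 => [set c | microchain c /\ augmentation c = 0]
  | q.+1 => [set c | microchain c /\ boundary c = (fun=> 0)]
  end.

Definition boundaries (p : nat) : set (chain p) :=
  [set boundary c | c in @microchain p.+1].

(* The quotient of the cycles by the boundaries, as its set of cosets. *)
Definition reduced_homology (p : nat) : set (set (chain p)) :=
  [set [set (fun tau => c tau + b tau) | b in @boundaries p]
     | c in @reduced_cycles p].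

(* The only element of the quotient is its zero, the coset of the boundaries. *)
Definition reduced_homology_trivial (p : nat) : Prop :=
  @reduced_homology p = [set @boundaries p].

End MuHomology.

(* Main.v *)
Require Import Defs.
From mathcomp Require Import all_boot all_order all_algebra.
From mathcomp Require Import all_classical.
From mathcomp Require Import topology_structure uniform_structure.

(* If y is not reachable from x by E-steps, let A be the set of points that
   are.  Infinitely close points are joined by a step in the extension of E, so
   each 1-microsimplex has both vertices in *A or both outside it, and the sum
   of the coefficients of the boundary of a 1-microchain over *A is 0.  The
   0-cycle g x - g y is therefore not a boundary when g is not 0.
   Sums of hyperfinite families are handled inside the internal universe: each
   set-theoretic fact used there is a first-order sentence proved in the
   standard universe, where separation holds for arbitrary predicates, and
   transferred. *)

(** Since A is a standard object, [*A] is internal, and this is what gives the sum over [*A] a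
    meaning: being a microsimplex is an external condition, whereas faces, coefficients and
    membership in [*A] are internal. Microsimplices enter only pointwise, edge by edge, through the
    equivalence of the two memberships; what follows is algebra of internal sums. The cost is that
    internality has to be proved for the functions and predicates that are summed over or used in an
    induction, since the hypernaturals admit induction for internal predicates only. A second
    difficulty is that [hsum] runs over an unspecified injective enumeration of the support, while a
    formal sum may repeat simplices; regrouping along fibres, which rests on exchanging two
    hyperfinite sums, connects the two. *)

Set Implicit Arguments.
Unset Strict Implicit.
Unset Printing Implicit Defensive.

Import GRing.Theory.

(** * Definability and transfer *)

(* One formula serves for all structures, so that truth can be transferred. *)
Definition definable (P : forall M : set_structure, (nat -> M) -> Prop) : Prop :=
  exists phi, forall (M : set_structure) (env : nat -> M),
    sat env phi <-> P M env.

Section Definable.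
Implicit Types P Q : forall M : set_structure, (nat -> M) -> Prop.

Lemma definable_elt i j : definable (fun M env => elt (env i) (env j)).
Proof. by exists (FElt i j). Qed.

Lemma definable_eq i j : definable (fun M env => env i = env j).
Proof. by exists (FEq i j). Qed.

Lemma definable_not P : definable P -> definable (fun M env => ~ P M env).
Proof. by case=> f hf; exists (FNot f) => M env /=; rewrite hf. Qed.

Lemma definable_and P Q : definable P -> definable Q ->
  definable (fun M env => P M env /\ Q M env).
Proof.
by case=> f hf [g hg]; exists (FAnd f g) => M env /=; rewrite hf hg.
Qed.

Lemma eq_definable P Q : (forall M env, P M env <-> Q M env) ->
  definable P -> definable Q.
Proof. by move=> e [f hf]; exists f => M env; rewrite hf. Qed.

Lemma definable_imp P Q : definable P -> definable Q ->
  definable (fun M env => P M env -> Q M env).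
Proof.
move=> hP hQ.
apply: eq_definable (definable_not (definable_and hP (definable_not hQ))).
by move=> M env; rewrite not_andE not_notE -implyE.
Qed.

Lemma definable_or P Q : definable P -> definable Q ->
  definable (fun M env => P M env \/ Q M env).
Proof.
move=> hP hQ.
apply: eq_definable
  (definable_not (definable_and (definable_not hP) (definable_not hQ))).
by move=> M env; rewrite not_andE !not_notE.
Qed.

Lemma definable_iff P Q : definable P -> definable Q ->
  definable (fun M env => P M env <-> Q M env).
Proof. by move=> hP hQ; apply: definable_and; apply: definable_imp. Qed.

(** [Q] receives the bound value as a separate argument; the first hypothesis says that it ignores
    variable [n], so that [FAll n] captures nothing else. With concrete numerals this holds by
    computation. *)
Lemma definable_all n (Q : forall M : set_structure, (nat -> M) -> M -> Prop) :
  (forall (M : set_structure) (env : nat -> M) (a b : M),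
    Q M (upd env n a) b = Q M env b) ->
  definable (fun M env => Q M env (env n)) ->
  definable (fun M env => forall a, Q M env a).
Proof.
move=> Qn [f hf]; exists (FAll n f) => M env /=.
by split=> h a; have := h a; rewrite hf Qn /upd eqxx.
Qed.

Lemma definable_ex n (Q : forall M : set_structure, (nat -> M) -> M -> Prop) :
  (forall (M : set_structure) (env : nat -> M) (a b : M),
    Q M (upd env n a) b = Q M env b) ->
  definable (fun M env => Q M env (env n)) ->
  definable (fun M env => exists a, Q M env a).
Proof.
move=> Qn dQ.
have := @definable_all n (fun M env a => ~ Q M env a) _ (definable_not dQ).
move=> /(_ _)/definable_not h.
apply: eq_definable (h _) => [M env|M env a b]; last by rewrite Qn.
by rewrite forallNE not_notE.
Qed.

Lemma definable_ex2 n
    (P Q : forall M : set_structure, (nat -> M) -> M -> Prop) :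
  (forall (M : set_structure) (env : nat -> M) (a b : M),
    P M (upd env n a) b = P M env b) ->
  (forall (M : set_structure) (env : nat -> M) (a b : M),
    Q M (upd env n a) b = Q M env b) ->
  definable (fun M env => P M env (env n)) ->
  definable (fun M env => Q M env (env n)) ->
  definable (fun M env => exists2 a, P M env a & Q M env a).
Proof.
move=> Pn Qn dP dQ.
apply: (@eq_definable (fun M env => exists a, P M env a /\ Q M env a)).
  by move=> M env; split=> [[a []]|[a]]; exists a.
apply: (@definable_ex n (fun M env a => P M env a /\ Q M env a)).
  by move=> M env a b; rewrite Pn Qn.
exact: definable_and.
Qed.

End Definable.

(** Relational, hence definable; single-valuedness of [F] is a separate hypothesis wherever it
    matters. *)
Definition app (M : set_structure) (F x y : M) :=
  exists2 p, is_pair p x y & elt p F.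

Lemma definable_and3 (P1 P2 P3 : forall M : set_structure, (nat -> M) -> Prop) :
  definable P1 -> definable P2 -> definable P3 ->
  definable (fun M env => [/\ P1 M env, P2 M env & P3 M env]).
Proof.
move=> h1 h2 h3; apply: eq_definable (definable_and h1 (definable_and h2 h3)).
by move=> M env; split=> [[? []]|[]].
Qed.

Lemma definable_and4
    (P1 P2 P3 P4 : forall M : set_structure, (nat -> M) -> Prop) :
  definable P1 -> definable P2 -> definable P3 -> definable P4 ->
  definable (fun M env => [/\ P1 M env, P2 M env, P3 M env & P4 M env]).
Proof.
move=> h1 h2 h3 h4.
apply: eq_definable (definable_and h1 (definable_and3 h2 h3 h4)).
by move=> M env; split=> [[? []]|[]].
Qed.

Lemma definable_and5
    (P1 P2 P3 P4 P5 : forall M : set_structure, (nat -> M) -> Prop) :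
  definable P1 -> definable P2 -> definable P3 -> definable P4 ->
  definable P5 -> definable
    (fun M env => [/\ P1 M env, P2 M env, P3 M env, P4 M env & P5 M env]).
Proof.
move=> h1 h2 h3 h4 h5.
apply: eq_definable (definable_and h1 (definable_and4 h2 h3 h4 h5)).
by move=> M env; split=> [[? []]|[]].
Qed.

(* Bound variables are named from [n] upwards: the free ones must be below. *)
Ltac dsolve n :=
  lazymatch goal with
  | |- definable (fun M env => elt _ _) => apply: definable_elt
  | |- definable (fun M env => _ = _) => apply: definable_eq
  | |- definable (fun M env => _ /\ _) => apply: definable_and; dsolve n
  | |- definable (fun M env => and3 _ _ _) => apply: definable_and3; dsolve n
  | |- definable (fun M env => and4 _ _ _ _) => apply: definable_and4; dsolve n
  | |- definable (fun M env => and5 _ _ _ _ _) => apply: definable_and5; dsolve n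
  | |- definable (fun M env => _ \/ _) => apply: definable_or; dsolve n
  | |- definable (fun M env => _ <-> _) => apply: definable_iff; dsolve n
  | |- definable (fun M env => ~ _) => apply: definable_not; dsolve n
  | |- definable (fun M env => exists2 a, _ & _) =>
      apply: (@definable_ex2 n);
        [by []|by []|dsolve constr:(S n)|dsolve constr:(S n)]
  | |- definable (fun M env => exists a, _) =>
      apply: (@definable_ex n); [by []|dsolve constr:(S n)]
  | |- definable (fun M env => forall a, _) =>
      first [ apply: definable_imp; dsolve n
            | apply: (@definable_all n); [by []|dsolve constr:(S n)] ]
  end.

Ltac definability n :=
  unfold app, is_nat, inductive_set, is_pair, is_upair, is_empty, is_succ;
  cbv beta; dsolve n.

(** First-order axioms shared by the standard and the internal universe: pairs and successors are
    developed once from them and used in both. *)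
Class basic_set_theory (M : set_structure) : Prop := BasicSetTheory {
  bst_ext : forall x y : M, (forall z, elt z x <-> elt z y) -> x = y;
  bst_foundation : forall x : M, (exists y, elt y x) ->
    exists2 y, elt y x & forall z, elt z y -> ~ elt z x;
  bst_pairing : forall a b : M, exists p, is_upair p a b;
  bst_union : forall x : M, exists y, forall z,
    elt z y <-> exists2 t, elt t x & elt z t
}.

(** * Pairs, successors and naturals from the basic axioms *)

Section Basics.
Context {M : set_structure} {HM : basic_set_theory M}.
Implicit Types x y z p q a b k n F : M.

Lemma is_pair_inj p x y x' y' :
  is_pair p x y -> is_pair p x' y' -> x = x' /\ y = y'.
Proof.
move=> h h'.
have [s hs] := bst_pairing x x.
have [t ht] := bst_pairing x y.
have [t' ht'] := bst_pairing x' y'.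
have ps : elt s p by apply/h; left.
have pt : elt t p by apply/h; right.
have pt' : elt t' p by apply/h'; right.
have ex : x = x'.
  have : elt x' s by case/h': ps => /(_ x') e; apply/e; left.
  by move=> /hs[] ->.
split=> //; subst x'.
have h1 : y = x \/ y = y'.
  have yt : elt y t by apply/ht; right.
  by case/h': pt => e; case/e: yt; auto.
have h2 : y' = x \/ y' = y.
  have yt : elt y' t' by apply/ht'; right.
  by case/h: pt' => e; case/e: yt; auto.
by case: h1 h2 => ->; auto => -[]->.
Qed.

Lemma pair_ex x y : exists p, is_pair p x y.
Proof.
have [s hs] := bst_pairing x x.
have [t ht] := bst_pairing x y.
have [p hp] := bst_pairing s t.
exists p => z; rewrite (hp z); split=> [[]->|[]h]; [by left|by right| |].
- by left; apply: bst_ext => w; rewrite (h w) (hs w).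
- by right; apply: bst_ext => w; rewrite (h w) (ht w).
Qed.

(** A chosen term allows rewriting with codes; formulas to be transferred keep the relation
    [is_pair], and [prP] passes between the two. *)
Definition pr x y : M := projT1 (cid (pair_ex x y)).

Lemma prP p x y : is_pair p x y <-> p = pr x y.
Proof.
rewrite /pr; case: cid => q /= hq; split=> [h|->//].
by apply: bst_ext => z; rewrite (h z) (hq z).
Qed.

Lemma is_pair_pr x y : is_pair (pr x y) x y.
Proof. exact/prP. Qed.

Lemma pr_inj x y x' y' : pr x y = pr x' y' -> x = x' /\ y = y'.
Proof. by move=> /prP h; apply: is_pair_inj h; apply/prP. Qed.

Lemma appE F x y : app F x y <-> elt (pr x y) F.
Proof. by split=> [[p /prP->//]|h]; exists (pr x y) => //; apply/prP. Qed.

Lemma elt_irr x : ~ elt x x.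
Proof.
move=> xx; have [s hs] := bst_pairing x x.
have [|y /hs ys /(_ x)] := bst_foundation (x := s).
  by exists x; apply/hs; left.
by case: ys => -> /(_ xx); apply; apply/hs; left.
Qed.

(** Foundation applied to {x, y}. It makes the von Neumann successor injective. *)
Lemma elt_asym x y : elt x y -> ~ elt y x.
Proof.
move=> xy yx; have [s hs] := bst_pairing x y.
have [|z /hs zs hz] := bst_foundation (x := s).
  by exists x; apply/hs; left.
by case: zs => e; subst z; [apply: (hz y yx)|apply: (hz x xy)]; apply/hs; auto.
Qed.

Lemma succ_ex x : exists y, is_succ y x.
Proof.
have [s hs] := bst_pairing x x; have [t ht] := bst_pairing x s.
have [u hu] := bst_union t; exists u => z; rewrite (hu z); split.
  by case=> w /ht[]->; [left|move=> /hs[]; right].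
by case=> [zx|->]; [exists x|exists s] => //; [apply/ht; left|apply/ht; right|
  apply/hs; left].
Qed.

Definition suc x : M := projT1 (cid (succ_ex x)).

Lemma sucP y x : is_succ y x <-> y = suc x.
Proof.
rewrite /suc; case: cid => q /= hq; split=> [h|->//].
by apply: bst_ext => z; rewrite (h z) (hq z).
Qed.

Lemma elt_suc z x : elt z (suc x) <-> elt z x \/ z = x.
Proof. by have /(_ z) := (sucP (suc x) x).2 erefl. Qed.

Lemma suc_inj x y : suc x = suc y -> x = y.
Proof.
move=> e.
have /elt_suc[xy|//] : elt x (suc y) by rewrite -e; apply/elt_suc; right.
have /elt_suc[yx|->//] : elt y (suc x) by rewrite e; apply/elt_suc; right.
by have := elt_asym xy yx.
Qed.

Lemma suc_nempty x : ~ is_empty (suc x).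
Proof. by move=> /(_ x); apply; apply/elt_suc; right. Qed.

Lemma empty_uniq x y : is_empty x -> is_empty y -> x = y.
Proof. by move=> hx hy; apply: bst_ext => z; split=> [/hx|/hy]. Qed.

Lemma nat_empty x : is_empty x -> is_nat x.
Proof. by move=> ex w [[e ee ew] _]; rewrite (empty_uniq ex ee). Qed.

Lemma nat_suc x : is_nat x -> is_nat (suc x).
Proof.
by move=> nx w hw; apply: hw.2 (nx w hw) _; apply/sucP.
Qed.

End Basics.

(** * Induction, recursion and enumeration in the standard universe *)

Section Standard.
Variables (U : set_structure) (HU : standard_universe U).

#[export] Instance standard_basic : basic_set_theory U.
Proof. by case: HU. Qed.

(** [P] is arbitrary because separation in [U] is: the naturals satisfying [P] form an inductive set
    of [U]. The internal universe only has [internal_nat_ind]. *)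
Lemma std_nat_ind (P : U -> Prop) :
  (forall e, is_empty e -> P e) -> (forall x, is_nat x -> P x -> P (suc x)) ->
  forall n, is_nat n -> P n.
Proof.
move=> P0 PS n nn; have [I hI] := su_infinity HU.
have [S hS] := su_separation HU I (fun x => is_nat x /\ P x).
suff /hS[_ []] : elt n S by [].
apply: nn; split.
  have [[e ee eI] _] := hI; exists e => //; apply/hS; split=> //.
  by split; [exact: nat_empty|exact: P0].
move=> y z /hS[yI [ny Py]] /[dup] hz /sucP ez; apply/hS; split.
  by apply: hI.2 hz.
by rewrite ez; split; [exact: nat_suc|exact: PS].
Qed.

Lemma std_omega : exists w : U, forall x, elt x w <-> is_nat x.
Proof.
have [I hI] := su_infinity HU.
have [w hw] := su_separation HU I (@is_nat U).
by exists w => x; rewrite hw; split=> [[]//|nx]; split=> //; apply: nx.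
Qed.

Lemma std_nat_elt (n k : U) : is_nat n -> elt k n -> is_nat k.
Proof.
move=> nn; move: n nn k; apply: std_nat_ind => [e ee k /ee//|x nx IH k].
by case/elt_suc=> [/IH|->].
Qed.

Lemma std_nat_trans (n k j : U) : is_nat n -> elt k n -> elt j k -> elt j n.
Proof.
move=> nn; move: n nn k j; apply: std_nat_ind => [e ee k j /ee//|x nx IH k j].
by move=> /elt_suc[kx jk|->]; rewrite elt_suc; left=> //; apply: IH jk.
Qed.

Lemma std_prod (A B : U) : exists C : U, forall p,
  elt p C <-> exists x y, [/\ elt x A, elt y B & is_pair p x y].
Proof.
have [s hs] := bst_pairing A B; have [AB hAB] := bst_union s.
have [P hP] := su_powerset HU AB; have [Q hQ] := su_powerset HU P.
have [C hC] := su_separation HU Q (fun p =>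
  exists x y, [/\ elt x A, elt y B & is_pair p x y]).
exists C => p; rewrite hC; split=> [[]//|h]; split=> //.
case: h => x [y [xA yB hp]]; apply/hQ => t /hp ht; apply/hP => z zt.
have xAB : elt x AB by apply/hAB; exists A => //; apply/hs; left.
have yAB : elt y AB by apply/hAB; exists B => //; apply/hs; right.
by case: ht => /(_ z)[/(_ zt)]; case=> ->.
Qed.

Section Iteration.
Variable (T : U).

Inductive iterated (a : U) : U -> U -> Prop :=
| iterated0 z of is_empty z : iterated a z a
| iteratedS k b c of iterated a k b & app T b c : iterated a (suc k) c.

Lemma iterated_fun a k b b' :
  (forall x y y', app T x y -> app T x y' -> y = y') ->
  iterated a k b -> iterated a k b' -> b = b'.
Proof.
move=> Tf h; elim: h b' => [z ez b' h|j c d _ IH cd b' h].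
  by inversion h as [|k' c d _ _ e]; subst => //; case: (suc_nempty ez).
inversion h as [z ez e|k' c' d' h1 h2 e]; subst.
  by case: (suc_nempty ez).
by move: (suc_inj e) => ?; subst; apply: Tf cd _; rewrite (IH _ h1).
Qed.

End Iteration.

(** The recursion theorem as a sentence that can be transferred: [I] is the graph of (a, k) |->
    T^k(a). One set treats all starting points, so that iterates, and later hyperfinite sums, depend
    internally on parameters. *)
Definition iteration (M : set_structure) : Prop := forall A T : M,
  (forall a, elt a A -> exists2 b, elt b A & app T a b) ->
  (forall a b b', app T a b -> app T a b' -> b = b') ->
  exists I,
    [/\ forall q, elt q I -> exists a k b p,
          [/\ is_pair q p b, is_pair p a k, elt a A, is_nat k & elt b A],
        forall a k p, elt a A -> is_nat k -> is_pair p a k ->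
          exists b, app I p b,
        forall p b b', app I p b -> app I p b' -> b = b',
        forall a z p, elt a A -> is_empty z -> is_pair p a z -> app I p a
      & forall a k k' p p' b c, is_pair p a k -> is_succ k' k ->
          is_pair p' a k' -> app I p b -> app T b c -> app I p' c].

(* Separation for arbitrary predicates applies to the inductive [iterated]. *)
Lemma std_iteration : iteration U.
Proof.
move=> A T Tt Tf; have [w hw] := std_omega.
have [Aw hAw] := std_prod A w; have [B hB] := std_prod Aw A.
have [I hI] := su_separation HU B (fun q => exists a k b,
  q = pr (pr a k) b /\ iterated T a k b).
have IE a k b : elt (pr (pr a k) b) I <->
    [/\ elt a A, is_nat k, elt b A & iterated T a k b].
  rewrite hI; split=> [[/hB[p [b' [/hAw[a' [k' [aA /hw nk /prP hp]]] bA /prP]]]]|].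
    rewrite hp => /pr_inj[/pr_inj[? ?] ?] [a2 [k2 [b2 []]]]; subst.
    by move=> /pr_inj[/pr_inj[<- <-] <-].
  case=> aA nk bA h; split; last by exists a, k, b.
  apply/hB; exists (pr a k), b; split=> //; last exact/prP.
  by apply/hAw; exists a, k; split=> //; [apply/hw|apply/prP].
exists I; split.
- move=> q /[dup] qI /hI[/hB[p [b [/hAw[a [k [aA /hw nk hp]]] bA hq]]] _].
  by exists a, k, b, p.
- move=> a k p aA nk /prP->.
  suff [b bA hb] : exists2 b, elt b A & iterated T a k b.
    by exists b; apply/appE/IE.
  move: k nk; apply: std_nat_ind => [e ee|k nk [b bA hb]].
    by exists a => //; apply: iterated0.
  by have [c cA bc] := Tt b bA; exists c => //; apply: iteratedS bc.
- move=> p b b' /appE /[dup] /hI[_ [a [k [b2 []]]]] e _.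
  case/pr_inj: e => -> _ /IE[_ _ _ h1] /appE/IE[_ _ _ h2].
  exact: iterated_fun h1 h2.
- move=> a z p aA ez /prP->; apply/appE/IE; split=> //; first exact: nat_empty.
  exact: iterated0.
- move=> a k k' p p' b c /prP-> /sucP-> /prP-> /appE/IE[aA nk bA h] bc.
  apply/appE/IE; split=> //; first exact: nat_suc; last exact: iteratedS bc.
  by have [c' c'A /(Tf _ _ _ bc)->] := Tt b bA.
Qed.

Definition injection (M : set_structure) (m E A : M) : Prop :=
  [/\ forall p, elt p E -> exists l a, [/\ is_pair p l a, elt l m & elt a A],
      forall l, elt l m -> exists a, app E l a,
      forall l a a', app E l a -> app E l a' -> a = a'
    & forall l l' a, app E l a -> app E l' a -> l = l'].

(** Two sequences are enumerated jointly because the support of the boundary of a 1-chain is covered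
    by both faces of its edges. The absence of repetition is what [is_hsum] demands. *)
Definition enumeration (M : set_structure) : Prop := forall A n F F' : M,
  is_nat n ->
  (forall i, elt i n -> exists2 a, elt a A & app F i a) ->
  (forall i, elt i n -> exists2 a, elt a A & app F' i a) ->
  (forall i a b, app F i a -> app F i b -> a = b) ->
  (forall i a b, app F' i a -> app F' i b -> a = b) ->
  exists m E, [/\ is_nat m, injection m E A &
    forall i a, elt i n -> app F i a \/ app F' i a -> exists l, app E l a].

(** If [a] is already a value nothing changes; otherwise it receives the fresh index [m], so
    injectivity survives. *)
Lemma std_injection_insert (A m E a : U) : is_nat m -> injection m E A ->
  elt a A -> exists m' E', [/\ is_nat m', injection m' E' A,
    exists l, app E' l a &
    forall l b, app E l b -> app E' l b].
Proof.
move=> nm inj aA; have [[l la]|na] := pselect (exists l, app E l a).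
  by exists m, E; split=> //; exists l.
have [E1 Et Ef Ei] := inj.
have [w hw] := std_omega; have [C hC] := std_prod w A.
have [E' hE'] := su_separation HU C (fun p => elt p E \/ p = pr m a).
have E'E l b : app E' l b <-> app E l b \/ (l = m /\ b = a).
  rewrite !appE hE'; split=> [[_ [|/pr_inj]]|]; auto.
  move=> h; have h' : elt (pr l b) E \/ pr l b = pr m a.
    by case: h => [|[-> ->]]; auto.
  split=> //; apply/hC; exists l, b; split=> //; last exact/prP.
    case: h => [/E1[l' [b' [/prP/pr_inj[-> _] lm _]]]|[-> _]].
      by apply/hw; apply: std_nat_elt lm.
    exact/hw.
  by case: h => [/E1[l' [b' [/prP/pr_inj[_ ->] _ bA]]]|[_ ->]].
have Em b : ~ app E m b.
  by move=> /appE/E1[l' [b' [/prP/pr_inj[<- _] /elt_irr]]].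
exists (suc m), E'; split=> //; first exact: nat_suc; last first.
- by move=> l b lb; apply/E'E; left.
- by exists m; apply/E'E; right.
split.
- move=> p /hE'[_ [/E1[l [b [h lm bA]]]|/prP h]].
    by exists l, b; split=> //; apply/elt_suc; left.
  by exists m, a; split=> //; apply/elt_suc; right.
- move=> l /elt_suc[/Et[b lb]|->]; first by exists b; apply/E'E; left.
  by exists a; apply/E'E; right.
- move=> l b b' /E'E[h|[e ->]] /E'E[h'|[e' ->]] //.
  + exact: Ef h h'.
  + by case: (Em b); rewrite -e'.
  + by case: (Em b'); rewrite -e.
- move=> l l' b /E'E[h|[e e1]] /E'E[h'|[e' e1']] //.
  + exact: Ei h h'.
  + by case: na; exists l; rewrite -e1'.
  + by case: na; exists l'; rewrite -e1.
  + by rewrite e e'.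
Qed.

Lemma std_enumeration : enumeration U.
Proof.
move=> A n F F' nn Ft Ft' Ff Ff'.
(* Induction over initial segments [k] of the fixed [n], since [F] and [F'] are total on [n] only;
   each step inserts the values of both at the new index. *)
suff h k : is_nat k -> (forall i, elt i k -> elt i n) ->
    exists m E, [/\ is_nat m, injection m E A &
    forall i a, elt i k -> app F i a \/ app F' i a -> exists l, app E l a].
  exact: h.
move: k; apply: std_nat_ind => [e ee _|k nk IH kn].
  exists e, e; split=> //; first exact: nat_empty.
    by split=> [p /ee|l /ee|l a a' [p _ /ee]|l l' a [p _ /ee]].
  by move=> i a /ee.
have [m [E [nm injE hE]]] := IH (fun i ik => kn i ((elt_suc i k).2 (or_introl ik))).
have kn' : elt k n by apply: kn; apply/elt_suc; right.
have [a aA Fa] := Ft k kn'; have [a' aA' Fa'] := Ft' k kn'.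
have [m1 [E1 [nm1 injE1 [l la] EE1]]] := std_injection_insert nm injE aA.
have [m2 [E2 [nm2 injE2 [l' la'] EE2]]] := std_injection_insert nm1 injE1 aA'.
exists m2, E2; split=> // i b /elt_suc[ik h|->].
  by have [j jb] := hE i b ik h; exists j; apply/EE2/EE1.
case=> [/(Ff _ _ _ Fa)<-|/(Ff' _ _ _ Fa')<-]; last by exists l'.
by exists l; apply: EE2.
Qed.

End Standard.

(** What the theory of hyperfinite sums uses of the internal universe. Separation shrinks to a
    schema: definable predicates, with the element as variable 0 and three parameters. *)
Class internal_set_theory (M : set_structure) : Prop := InternalSetTheory {
  ist_basic :: basic_set_theory M;
  ist_separation : forall phi : forall N : set_structure, N -> N -> N -> N -> Prop,
    definable (fun N env => phi N (env 0) (env 1) (env 2) (env 3)) ->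
    forall B a b c : M, exists H, forall z,
      elt z H <-> elt z B /\ phi M z a b c;
  ist_omega : exists w : M, forall x, elt x w <-> is_nat x;
  ist_nat_elt : forall n k : M, is_nat n -> elt k n -> is_nat k;
  ist_nat_trans : forall n k j : M,
    is_nat n -> elt k n -> elt j k -> elt j n;
  ist_prod : forall A B : M, exists C : M, forall p,
    elt p C <-> exists x y, [/\ elt x A, elt y B & is_pair p x y];
  ist_iteration : iteration M;
  ist_enumeration : enumeration M
}.

(** * Transfer to the internal universe *)

Section Transfer.
Variables (U : set_structure) (HU : standard_universe U).
Variable V : nonstandard_extension U.

Lemma transfer (P : set_structure -> Prop) :
  definable (fun M _ => P M) -> P U -> P V.
Proof.
(* [su_infinity] supplies an object for a constant environment, on which the truth of a sentence
   does not depend. *)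
case=> f hf PU; have [u _] := su_infinity HU.
apply/(hf V (fun=> star V u)).
by apply/(star_elementary V f (fun=> u))/hf.
Qed.

Lemma transfer2 (P : forall M : set_structure, M -> M -> Prop) (a b : U) :
  definable (fun M env => P M (env 0) (env 1)) ->
  P U a b -> P V (star V a) (star V b).
Proof.
case=> f hf PU.
pose env i := if i == 0%N then a else b.
apply/(hf V (fun i => star V (env i))).
by apply/(star_elementary V f env)/hf.
Qed.

Lemma extension_internal : internal_set_theory V.
Proof.
have HB : basic_set_theory U by exact: standard_basic.
split.
- split.
  + move: (@bst_ext U HB); apply: (@transfer (fun M => forall x y : M,
      (forall z, elt z x <-> elt z y) -> x = y)).
    by definability 0.
  + move: (@bst_foundation U HB); apply: (@transfer (fun M => forall x : M,
      (exists y, elt y x) ->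
      exists2 y, elt y x & forall z, elt z y -> ~ elt z x)).
    by definability 0.
  + move: (@bst_pairing U HB); apply: (@transfer (fun M => forall a b : M,
      exists p, is_upair p a b)).
    by definability 0.
  + move: (@bst_union U HB); apply: (@transfer (fun M => forall x : M,
      exists y, forall z, elt z y <-> exists2 t, elt t x & elt z t)).
    by definability 0.
- move=> phi dphi.
  apply: (@transfer (fun M => forall B a b c : M, exists H, forall z,
      elt z H <-> elt z B /\ phi M z a b c)); last first.
    by move=> B a b c; exact: (su_separation HU).
  (* [phi] reads the element and its parameters as variables 0 to 3, so [B] and [H] get the names 4
     and 5. *)
  apply: (@definable_all 4) => //; apply: (@definable_all 1) => //.
  apply: (@definable_all 2) => //; apply: (@definable_all 3) => //.
  apply: (@definable_ex 5) => //; apply: (@definable_all 0) => //.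
  apply: definable_iff; first exact: definable_elt.
  by apply: definable_and => //; exact: definable_elt.
- move: (std_omega HU).
  apply: (@transfer (fun M => exists w : M, forall x, elt x w <-> is_nat x)).
  by definability 0.
- move: (std_nat_elt HU).
  apply: (@transfer (fun M => forall n k : M, is_nat n -> elt k n -> is_nat k)).
  by definability 0.
- move: (std_nat_trans HU).
  apply: (@transfer (fun M => forall n k j : M,
    is_nat n -> elt k n -> elt j k -> elt j n)).
  by definability 0.
- suff h : forall A B : V, exists C : V, forall p,
    elt p C <-> exists x y, elt x A /\ (elt y B /\ is_pair p x y).
    move=> A B; have [C hC] := h A B; exists C => p; rewrite hC.
    by split=> -[x [y]] => [[? []]|[]]; exists x, y.
  apply: (@transfer (fun M => forall A B : M, exists C : M, forall p,
    elt p C <-> exists x y, elt x A /\ (elt y B /\ is_pair p x y))).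
    by definability 0.
  move=> A B; have [C hC] := std_prod HU A B; exists C => p; rewrite hC.
  by split=> -[x [y]] => [[]|[? []]]; exists x, y.
- apply: (@transfer iteration); last exact: std_iteration.
  by rewrite /iteration /enumeration /injection; definability 0.
- apply: (@transfer enumeration); last exact: std_enumeration.
  by rewrite /iteration /enumeration /injection; definability 0.
Qed.
End Transfer.

(** * Internal sets, predicates and functions *)

Lemma sval_injective (T : Type) (P : T -> Prop) : injective (@sval T P).
Proof. by move=> [x hx] [y hy] /= e; subst y; rewrite (Prop_irrelevance hx hy). Qed.

(** Makes the elements of [A] correspond one to one to the elements of a set of [M]. Quantifiers
    over [A] become quantifiers bounded by that set, and separation applies to predicates on [A]. *)
Class coding (M : set_structure) (A : coded_type M) := Coding {
  code : A -> M;
  codesE : forall t x, codes t x <-> x = code t;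
  code_inj : injective code;
  code_set : exists S, forall u, elt u S <-> exists t, u = code t
}.

Section InternalLogic.
Context {M : set_structure} {HM : internal_set_theory M}.

(* [S] may contain objects that are not codes of elements of [A]. *)
Definition internal_pred (A : coded_type M) {cA : coding A} (P : A -> Prop) :=
  exists S, forall t, elt (code t) S <-> P t.

(** Separation inside the set of codes. Closure lemmas for internal predicates and functions mostly
    reduce to it by exhibiting a formula about codes. *)
Lemma internal_pred_definable (A : coded_type M) {cA : coding A}
    (phi : forall N : set_structure, N -> N -> N -> N -> Prop) (a b c : M)
    (P : A -> Prop) :
  definable (fun N env => phi N (env 0) (env 1) (env 2) (env 3)) ->
  (forall t, P t <-> phi M (code t) a b c) -> internal_pred P.
Proof.
move=> dphi hP; have [B hB] := code_set (A := A).
have [S hS] := ist_separation dphi B a b c.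
exists S => t; rewrite hS hP; split=> [[]//|h]; split=> //.
by apply/hB; exists t.
Qed.

Arguments internal_pred_definable {A cA} phi a b c {P}.

Lemma eq_internal_pred (A : coded_type M) {cA : coding A} (P Q : A -> Prop) :
  (forall t, P t <-> Q t) -> internal_pred P -> internal_pred Q.
Proof. by move=> e [S hS]; exists S => t; rewrite hS e. Qed.

Lemma internal_pred_and (A : coded_type M) {cA : coding A} (P Q : A -> Prop) :
  internal_pred P -> internal_pred Q -> internal_pred (fun t => P t /\ Q t).
Proof.
move=> [S hS] [T hT].
apply: (@internal_pred_definable A cA
  (fun N z a b c => elt z a /\ elt z b) S T S); first by definability 4.
by move=> t; rewrite hS hT.
Qed.

Lemma internal_pred_not (A : coded_type M) {cA : coding A} (P : A -> Prop) :
  internal_pred P -> internal_pred (fun t => ~ P t).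
Proof.
move=> [S hS].
apply: (@internal_pred_definable A cA (fun N z a b c => ~ elt z a) S S S).
  by definability 4.
by move=> t; rewrite hS.
Qed.

Lemma internal_pred_or (A : coded_type M) {cA : coding A} (P Q : A -> Prop) :
  internal_pred P -> internal_pred Q -> internal_pred (fun t => P t \/ Q t).
Proof.
move=> [S hS] [T hT].
apply: (@internal_pred_definable A cA
  (fun N z a b c => elt z a \/ elt z b) S T S); first by definability 4.
by move=> t; rewrite hS hT.
Qed.

Lemma internal_pred_imp (A : coded_type M) {cA : coding A} (P Q : A -> Prop) :
  internal_pred P -> internal_pred Q -> internal_pred (fun t => P t -> Q t).
Proof.
move=> hP hQ; have := internal_pred_or (internal_pred_not hP) hQ.
by apply: eq_internal_pred => t; rewrite implyE.
Qed.

Definition prod_ctype (A B : coded_type M) {cA : coding A} {cB : coding B} :=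
  @CodedType M (A * B)%type (fun t x => x = pr (code t.1) (code t.2)).

Arguments prod_ctype A B {cA cB}.

#[export, program] Instance prod_coding (A B : coded_type M)
    {cA : coding A} {cB : coding B} : coding (prod_ctype A B) :=
  { code := fun t : prod_ctype A B => pr (code t.1) (code t.2) }.
Next Obligation. by []. Qed.
Next Obligation.
by move=> A B cA cB [a b] [a' b'] /pr_inj[/= /code_inj-> /code_inj->].
Qed.
Next Obligation.
move=> A B cA cB.
have [SA hA] := code_set (A := A); have [SB hB] := code_set (A := B).
have [C hC] := ist_prod SA SB; exists C => u; rewrite hC; split.
  by case=> x [y [/hA[a ->] /hB[b ->] /prP->]]; exists (a, b).
case=> -[a b] ->; exists (code a), (code b); split; last exact/prP.
  by apply/hA; exists a.
by apply/hB; exists b.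
Qed.

Section Functions.
Context {A B C : coded_type M} {cA : coding A} {cB : coding B} {cC : coding C}.

Lemma internal_funE (f : A -> B) : internal_fun f <->
  exists F, forall p, elt p F <-> exists t, p = pr (code t) (code (f t)).
Proof.
split=> -[F hF]; exists F => p; rewrite hF; split.
- by case=> t [x [y [/codesE-> /codesE-> /prP->]]]; exists t.
- by case=> t ->; exists t, (code t), (code (f t));
  split; [exact/codesE|exact/codesE|exact/prP].
- by case=> t ->; exists t, (code t), (code (f t));
  split; [exact/codesE|exact/codesE|exact/prP].
- by case=> t [x [y [/codesE-> /codesE-> /prP->]]]; exists t.
Qed.

Lemma internal_fun_app (f : A -> B) : internal_fun f ->
  exists F, forall t y, app F (code t) y <-> y = code (f t).
Proof.
move=> /internal_funE[F hF]; exists F => t y; rewrite appE hF; split.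
  by case=> t' /pr_inj[/code_inj->].
by move=> ->; exists t.
Qed.

(** Turns closure properties of functions into those of predicates. In the converse direction the
    graph is cut out of the set of codes of pairs, as [S] may contain other objects. *)
Lemma internal_graph (f : A -> B) : internal_fun f <->
  internal_pred (fun p : prod_ctype A B => f p.1 = p.2).
Proof.
split=> [/internal_funE[F hF]|[S hS]].
  exists F => -[t b] /=; rewrite hF; split=> [[t' /pr_inj[]]|<-].
    by move=> /code_inj<- /code_inj.
  by exists t.
apply/internal_funE; have [D hD] := code_set (A := prod_ctype A B).
have [F hF] := ist_separation (phi := fun N z a b c => elt z a)
  (definable_elt _ _) D S S S.
exists F => p; rewrite hF; split.
  by case=> /hD[[t b] ->] /hS/= e; exists t; rewrite e.
case=> t ->; split; first by apply/hD; exists (t, f t).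
exact/(hS (t, f t)).
Qed.

End Functions.

Section Terms.
Context {A B C : coded_type M} {cA : coding A} {cB : coding B} {cC : coding C}.

(** Serves for identities and for inclusions such as [elt_nat], which change the type of an argument
    but not its code. *)
Lemma internal_code_preserving (f : A -> B) :
  (forall t, code (f t) = code t) -> internal_fun f.
Proof.
move=> fE; apply/internal_graph; have [w _] := ist_omega.
apply: (internal_pred_definable (A := prod_ctype A B)
  (fun N z a b c => exists x, is_pair z x x) w w w).
  by definability 4.
move=> [t b] /=; split=> [<-|[x /prP/pr_inj[ht hb]]].
  by exists (code t); rewrite prP fE.
by apply: code_inj; rewrite fE ht hb.
Qed.

(** Serves for [fst] and, since simplices are coded by nested pairs, for the first vertex;
    [internal_right_component] does the same for [snd] and [last_face]. *)
Lemma internal_left_component (f : A -> B) :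
  (forall t, exists r, code t = pr (code (f t)) r) -> internal_fun f.
Proof.
move=> fE; apply/internal_graph; have [w _] := ist_omega.
apply: (internal_pred_definable (A := prod_ctype A B)
  (fun N z a b c => exists q x r, is_pair z q x /\ is_pair q x r) w w w).
  by definability 4.
move=> [t b] /=; have [r hr] := fE t; split=> [<-|[q [x [r' []]]]].
  by exists (code t), (code (f t)), r; split; [exact: is_pair_pr|exact/prP].
move=> /prP/pr_inj[<- <-] /prP; rewrite hr => /pr_inj[/code_inj-> _].
by [].
Qed.

Lemma internal_right_component (f : A -> B) :
  (forall t, exists r, code t = pr r (code (f t))) -> internal_fun f.
Proof.
move=> fE; apply/internal_graph; have [w _] := ist_omega.
apply: (internal_pred_definable (A := prod_ctype A B)
  (fun N z a b c => exists q x r, is_pair z q x /\ is_pair q r x) w w w).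
  by definability 4.
move=> [t b] /=; have [r hr] := fE t; split=> [<-|[q [x [r' []]]]].
  by exists (code t), (code (f t)), r; split; [exact: is_pair_pr|exact/prP].
move=> /prP/pr_inj[<- <-] /prP; rewrite hr => /pr_inj[_ /code_inj->].
by [].
Qed.

Lemma internal_cst (b : B) : internal_fun (fun _ : A => b).
Proof.
apply/internal_graph.
apply: (internal_pred_definable (A := prod_ctype A B)
  (fun N z a b c => exists x, is_pair z x a) (code b) (code b) (code b)).
  by definability 4.
move=> [t b'] /=; split=> [<-|[x /prP/pr_inj[_ /code_inj->//]]].
by exists (code t); rewrite prP.
Qed.

Lemma internal_comp (f : A -> B) (g : B -> C) :
  internal_fun f -> internal_fun g -> internal_fun (fun t => g (f t)).
Proof.
move=> /internal_fun_app[F hF] /internal_fun_app[G hG]; apply/internal_graph.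
apply: (internal_pred_definable (A := prod_ctype A C)
  (fun N z a b c =>
     exists x y w, [/\ is_pair z x w, app a x y & app b y w]) F G G).
  by definability 4.
move=> [t c] /=; split=> [<-|[x [y [z []]]]].
  exists (code t), (code (f t)), (code (g (f t))).
    by split; [exact: is_pair_pr|exact/hF|exact/hG].
by move=> /prP/pr_inj[<- <-] /hF-> /hG/code_inj->.
Qed.

Lemma internal_pair (f : A -> B) (g : A -> C) :
  internal_fun f -> internal_fun g ->
  @internal_fun M A (prod_ctype B C) (fun t => (f t, g t)).
Proof.
move=> /internal_fun_app[F hF] /internal_fun_app[G hG].
apply/(internal_graph (B := prod_ctype B C)).
apply: (internal_pred_definable (A := prod_ctype A (prod_ctype B C))
  (fun N z a b c =>
     exists x q, is_pair z x q /\ exists y w,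
       [/\ is_pair q y w, app a x y & app b x w]) F G G).
  by definability 4.
move=> [t [b c]] /=; split=> [[<- <-]|[x [q []]]].
  exists (code t), (pr (code (f t)) (code (g t))); split; first exact: is_pair_pr.
  exists (code (f t)), (code (g t)).
  by split; [exact: is_pair_pr|exact/hF|exact/hG].
move=> /prP/pr_inj[<- <-] [y [z []]] /prP + /hF e1 /hG e2.
by rewrite e1 e2 => /pr_inj[/code_inj-> /code_inj->].
Qed.

End Terms.

Lemma internal_id (A : coded_type M) {cA : coding A} :
  internal_fun (fun t : A => t).
Proof. exact: internal_code_preserving. Qed.

Lemma internal_fst (A B : coded_type M) {cA : coding A} {cB : coding B} :
  @internal_fun M (prod_ctype A B) A fst.
Proof.
by apply: internal_left_component => -[a b]; exists (code b).
Qed.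

Lemma internal_snd (A B : coded_type M) {cA : coding A} {cB : coding B} :
  @internal_fun M (prod_ctype A B) B snd.
Proof.
by apply: internal_right_component => -[a b]; exists (code a).
Qed.

Section Predicates.
Context {A B : coded_type M} {cA : coding A} {cB : coding B}.

Lemma internal_pred_cst (P : Prop) : internal_pred (fun _ : A => P).
Proof.
have [w _] := ist_omega; have [hP|nP] := pselect P.
  apply: (internal_pred_definable (A := A) (fun N z a b c => z = z) w w w) => //.
  by definability 4.
apply: (internal_pred_definable (A := A) (fun N z a b c => ~ z = z) w w w) => //.
by definability 4.
Qed.

Lemma internal_pred_comp (f : A -> B) (P : B -> Prop) :
  internal_fun f -> internal_pred P -> internal_pred (fun t => P (f t)).
Proof.
move=> /internal_fun_app[F hF] [S hS].
apply: (internal_pred_definable (A := A)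
  (fun N z a b c => exists2 y, app a z y & elt y b) F S S).
  by definability 4.
move=> t; split=> [/hS h|[y /hF-> /hS//]].
by exists (code (f t)) => //; apply/hF.
Qed.

Lemma internal_pred_ex (P : A -> B -> Prop) :
  internal_pred (fun p : prod_ctype A B => P p.1 p.2) ->
  internal_pred (fun t => exists b, P t b).
Proof.
move=> [S hS]; have [B' hB] := code_set (A := B).
apply: (internal_pred_definable (A := A)
  (fun N z a b c => exists2 y, app a z y & elt y b) S B' B').
  by definability 4.
move=> t; split=> [[b h]|[y + /hB[b e]]].
  exists (code b); last by apply/hB; exists b.
  by apply/appE/(hS (t, b)).
by rewrite e => /appE/(hS (t, b)) h; exists b.
Qed.

End Predicates.

Section Conditionals.
Context {A B : coded_type M} {cA : coding A} {cB : coding B}.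

Lemma internal_pred_eq (f g : A -> B) :
  internal_fun f -> internal_fun g -> internal_pred (fun t => f t = g t).
Proof.
move=> hf /internal_graph hg.
pose proof (internal_pair internal_id hf) as h.
by refine (eq_internal_pred _ (internal_pred_comp h hg)) => t.
Qed.

Lemma internal_pred_elt (S : M) : internal_pred (fun t : A => elt (code t) S).
Proof. by exists S. Qed.

Lemma internal_if (P : A -> Prop) (f g : A -> B) :
  internal_pred P -> internal_fun f -> internal_fun g ->
  internal_fun (fun t => if `[< P t >] then f t else g t).
Proof.
move=> hP /internal_graph hf /internal_graph hg; apply/internal_graph.
pose proof (internal_pred_comp (internal_fst (B := B)) hP) as hP'.
refine (eq_internal_pred _ (internal_pred_or (internal_pred_and hP' hf)
  (internal_pred_and (internal_pred_not hP') hg))).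
by move=> -[t b] /=; case: asboolP => h; tauto.
Qed.

End Conditionals.

#[export, program] Instance naturals_coding : coding (naturals M) :=
  { code := fun n : naturals M => sval n }.
Next Obligation. by []. Qed.
Next Obligation. exact: sval_injective. Qed.
Next Obligation.
have [w hw] := ist_omega; exists w => u; rewrite hw.
by split=> [nu|[n ->]]; [exists (exist _ u nu)|exact: (svalP n)].
Qed.

#[export, program] Instance elements_coding (a : M) : coding (elements a) :=
  { code := fun n : elements a => sval n }.
Next Obligation. by []. Qed.
Next Obligation. by move=> a; exact: sval_injective. Qed.
Next Obligation.
move=> a; exists a => u.
by split=> [nu|[n ->]]; [exists (exist _ u nu)|exact: (svalP n)].
Qed.

#[export, program] Instance zcoded_coding (G : internal_zmod M) :
    coding (zcoded G) :=
  { code := fun g : zcoded G => zcode g }.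
Next Obligation. by []. Qed.
Next Obligation. by move=> G; apply: zcode_inj. Qed.
Next Obligation.
move=> G; exists (zset G) => u; rewrite zsetP.
by split=> -[g]; exists g.
Qed.

Lemma internal_add (A : coded_type M) {cA : coding A} (G : internal_zmod M)
    (f g : A -> zcoded G) :
  internal_fun f -> internal_fun g ->
  @internal_fun M A (zcoded G) (fun t => (f t : G) + g t)%R.
Proof.
move=> hf hg.
have hadd : @internal_fun M (prod_ctype (zcoded G) (zcoded G)) (zcoded G)
    (fun p => (p.1 : G) + p.2)%R.
  apply/internal_funE; have [F hF] := zadd_internal G.
  exists F => q; rewrite hF; split=> [[g1 [g2 [p [/prP-> /prP->]]]]|[[g1 g2] ->]].
    by exists (g1, g2).
  exists g1, g2, (pr (zcode g1) (zcode g2)).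
  by split; exact: is_pair_pr.
exact: (internal_comp (internal_pair hf hg) hadd).
Qed.

(** * Hypernaturals and internal induction *)

Section Naturals.
Implicit Types n k : naturals M.

Lemma empty_ex : exists e : M, is_empty e.
Proof.
have [w _] := ist_omega.
have [e he] := ist_separation (phi := fun N z a b c => ~ z = z)
  (definable_not (definable_eq _ _)) w w w w.
by exists e => z /he[_].
Qed.

Definition hnat0 : naturals M :=
  exist _ (projT1 (cid empty_ex)) (nat_empty (projT2 (cid empty_ex))).

Lemma hnat0P n : is_empty (sval n) <-> n = hnat0.
Proof.
have h0 : is_empty (sval hnat0) by rewrite /hnat0; case: cid.
split=> [h|->//]; apply: sval_injective.
exact: empty_uniq.
Qed.

Definition hnatS n : naturals M := exist _ (suc (sval n)) (nat_suc (svalP n)).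

Lemma hnatSP k n : is_succ (sval k) (sval n) <-> k = hnatS n.
Proof.
rewrite sucP; split=> [h|->//].
exact: sval_injective.
Qed.

Lemma internal_hnatS : internal_fun hnatS.
Proof.
apply/internal_graph; have [w _] := ist_omega.
apply: (internal_pred_definable
  (A := prod_ctype (naturals M) (naturals M)) (fun N z a b c =>
  exists x y, is_pair z x y /\ is_succ y x) w w w); first by definability 4.
move=> [n k] /=; split=> [<-|[x [y []]]].
  by exists (sval n), (sval (hnatS n)); split; [exact: is_pair_pr|exact/sucP].
by move=> /prP/pr_inj[/= <- <-] /hnatSP->.
Qed.

(** A hypernatural belongs to every inductive set of [M], and separation makes such a set out of an
    internal [P]. Each use has to prove internality as its first goal. *)
Lemma internal_nat_ind (P : naturals M -> Prop) :
  internal_pred P -> P hnat0 -> (forall n, P n -> P (hnatS n)) -> forall n, P n.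
Proof.
move=> [S hS] P0 PS n.
have [w hw] := ist_omega.
have [T hT] := ist_separation (phi := fun N z a b c => elt z a)
  (definable_elt _ _) w S S S.
suff : elt (sval n) T by move=> /hT[_ /(hS n)].
apply: (svalP n); split.
  exists (sval hnat0); first exact/hnat0P.
  by apply/hT; split; [exact/hw/(svalP hnat0)|exact/(hS hnat0)].
move=> y z /hT[/hw ny yS] /sucP->; apply/hT.
pose y' : naturals M := exist _ y ny.
split; first by apply/hw/nat_suc.
by apply/(hS (hnatS y')); apply/PS/(hS y').
Qed.

Definition elt_nat n (i : elements (sval n)) : naturals M :=
  exist _ (sval i) (ist_nat_elt (svalP n) (svalP i)).

Lemma internal_elt_nat n : internal_fun (@elt_nat n).
Proof. exact: internal_code_preserving. Qed.

Lemma elt_nat_inj n : injective (@elt_nat n).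
Proof.
by move=> i j /(congr1 sval)/= h; apply: sval_injective.
Qed.

Lemma internal_nat_lt n : internal_pred (fun k => elt (sval k) (sval n)).
Proof. exact: internal_pred_elt. Qed.

Lemma internal_nat_gt n : internal_pred (fun k => elt (sval n) (sval k)).
Proof.
apply: (internal_pred_definable (A := naturals M) (fun N z a b c => elt a z)
  (sval n) (sval n) (sval n)); first by definability 4.
by [].
Qed.

End Naturals.

End InternalLogic.

Arguments prod_ctype {M HM} A B {cA cB}.
Arguments internal_pred_definable {M HM A cA} phi a b c {P}.

(** * Hyperfinite sums *)

Section Sums.
Context {M : set_structure} {HM : internal_set_theory M}.

Lemma internal_fst_of (A B C : coded_type M) {cA : coding A} {cB : coding B}
    {cC : coding C} (f : A -> prod_ctype B C) :
  internal_fun f -> @internal_fun M A B (fun t => (f t).1).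
Proof. by move=> hf; exact: (internal_comp hf internal_fst). Qed.

Lemma internal_snd_of (A B C : coded_type M) {cA : coding A} {cB : coding B}
    {cC : coding C} (f : A -> prod_ctype B C) :
  internal_fun f -> @internal_fun M A C (fun t => (f t).2).
Proof. by move=> hf; exact: (internal_comp hf internal_snd). Qed.

Lemma internal_comp2 (A B C D : coded_type M) {cA : coding A} {cB : coding B}
    {cC : coding C} {cD : coding D} (f : A -> B) (g : A -> C)
    (h : B -> C -> D) :
  internal_fun f -> internal_fun g ->
  @internal_fun M (prod_ctype B C) D (fun p => h p.1 p.2) ->
  internal_fun (fun t => h (f t) (g t)).
Proof. by move=> hf hg hh; exact: (internal_comp (internal_pair hf hg) hh). Qed.

(** [iteration] for coded types. The gain is internality jointly in the starting point and the
    number of steps. *)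
Lemma internal_iterate (A : coded_type M) {cA : coding A} (t : A -> A) :
  internal_fun t -> exists it : A -> naturals M -> A,
    [/\ @internal_fun M (prod_ctype A (naturals M)) A (fun p => it p.1 p.2),
        forall a, it a hnat0 = a
      & forall a k, it a (hnatS k) = t (it a k)].
Proof.
move=> /internal_funE[T hT]; have [SA hA] := code_set (A := A).
have TE x y : app T x y <-> exists a, x = code a /\ y = code (t a).
  rewrite appE hT; split=> [[a /pr_inj[]]|[a [-> ->]]]; by exists a.
have [|x y y'|I [I1 I2 I3 I4 I5]] := ist_iteration (A := SA) (T := T).
- move=> x /hA[a ->]; exists (code (t a)); first by apply/hA; exists (t a).
  by apply/TE; exists a.
- by move=> /TE[a [-> ->]] /TE[b [/code_inj-> ->]].
have /choice[it hit] (p : prod_ctype A (naturals M)) :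
    exists b, app I (code p) (code b).
  have [|//||b hb] := I2 (code p.1) (code p.2) (code p).
  + by apply/hA; exists p.1.
  + exact: (svalP p.2).
  + exact: is_pair_pr.
  move: (hb) => /appE/I1[a [k [b' [p' [/prP/pr_inj[_ e] _ _ _ /hA[c ec]]]]]].
  by exists c; rewrite -ec -e.
have itE p b : app I (code p) (code b) -> it p = b.
  by move=> h; apply: code_inj; exact: I3 (hit p) h.
exists (fun a k => it (a, k)); split.
- apply/internal_graph; exists I => -[[a k] b] /=.
  rewrite -appE; split=> [/(itE (a, k))//|<-]; exact: (hit (a, k)).
- move=> a; apply: itE; apply: (I4 _ (sval hnat0)).
  + by apply/hA; exists a.
  + exact/hnat0P.
  + exact: is_pair_pr.
- move=> a k; apply: itE.
  apply: (I5 (code a) (sval k) (sval (hnatS k)) _ _ _ _ (is_pair_pr _ _) _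
    (is_pair_pr _ _) (hit (a, k))); first exact/hnatSP.
  by apply/TE; exists (it (a, k)).
Qed.

Variable G : internal_zmod M.
Local Open Scope ring_scope.

Section PartialSums.
Variables (C : coded_type M) (cC : coding C) (n : naturals M).
Variable f : C -> elements (sval n) -> G.
Hypothesis hf : @internal_fun M (prod_ctype C (elements (sval n))) (zcoded G)
  (fun p => f p.1 p.2).

(** Iteration needs a summand at every hypernatural, whereas [f] has values below [n] only. *)
Lemma extension_by_zero : exists g : C -> naturals M -> G,
  @internal_fun M (prod_ctype C (naturals M)) (zcoded G)
    (fun p => g p.1 p.2) /\ forall c i, g c (elt_nat i) = f c i.
Proof.
pose (P := fun (q : prod_ctype (prod_ctype C (naturals M)) (zcoded G))
  (i : elements (sval n)) => elt_nat i = q.1.2).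
(* The graph is a disjunction and does not come from [internal_if], because the value below [n]
   requires an index of type [elements (sval n)]. *)
pose (Q := fun q : prod_ctype (prod_ctype C (naturals M)) (zcoded G) =>
  (exists i, P q i /\ f q.1.1 i = q.2) \/ (~ (exists i, P q i) /\ q.2 = 0)).
have hP : internal_pred (fun r : prod_ctype (prod_ctype (prod_ctype C
    (naturals M)) (zcoded G)) (elements (sval n)) => P r.1 r.2).
  apply: (internal_pred_eq (B := naturals M)).
    exact: (internal_comp internal_snd (@internal_elt_nat _ _ n)).
  exact/internal_snd_of/internal_fst_of/internal_fst.
have hQ : internal_pred Q.
  apply: internal_pred_or; last first.
    apply: internal_pred_and.
      by apply: internal_pred_not; apply: internal_pred_ex hP.
    by apply: (internal_pred_eq (B := zcoded G));
      [exact: internal_snd|exact: internal_cst].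
  apply: (internal_pred_ex (B := elements (sval n))
    (P := fun q i => P q i /\ f q.1.1 i = q.2)).
  apply: internal_pred_and => //.
  apply: (internal_pred_eq (B := zcoded G)).
    apply: (internal_comp2 (B := C) (C := elements (sval n)) _ _ hf).
      exact/internal_fst_of/internal_fst_of/internal_fst.
    exact: internal_snd.
  exact/internal_snd_of/internal_fst.
have Qfun p v w : Q (p, v) -> Q (p, w) -> v = w.
  case=> -[h1 h2]; case=> -[h3 h4]; rewrite /P /= in h1 h2 h3 h4.
  - have [[e1 e2] [e3 e4]] := (h2, h4); rewrite -e2 -e4; congr f.
    by apply: elt_nat_inj; rewrite e1.
  - by case: h3; exists h1; case: h2.
  - by case: h1; exists h3; case: h4.
  - by rewrite h2.
have /choice[g hg] (p : prod_ctype C (naturals M)) : exists v, Q (p, v).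
  have [[i hi]|h] := pselect (exists i : elements (sval n), elt_nat i = p.2).
    by exists (f p.1 i); left; exists i.
  by exists 0; right.
exists (fun c k => g (c, k)); split.
  apply/internal_graph; apply: eq_internal_pred hQ => -[[c k] v] /=.
  by split=> [h|<-]; [exact: Qfun (hg _) h|exact: hg].
move=> c i; apply: Qfun (hg (c, elt_nat i)) _.
by left; exists i.
Qed.

Local Notation state := (prod_ctype (prod_ctype C (naturals M)) (zcoded G)).

Lemma partial_sums : exists s : C -> naturals M -> G,
  [/\ @internal_fun M (prod_ctype C (naturals M)) (zcoded G)
         (fun p => s p.1 p.2),
      forall c, s c hnat0 = 0
    & forall c i, s c (hnatS (elt_nat i)) = s c (elt_nat i) + f c i].
Proof.
have [g [hg gE]] := extension_by_zero.
(* A state holds the parameter, the counter and the sum so far: the iterated map has no other access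
   to the parameter or to the step number. *)
pose (t := fun q : state =>
  ((q.1.1, hnatS q.1.2), (q.2 : G) + g q.1.1 q.1.2) : state).
have ht : internal_fun t.
  have h1 : @internal_fun M state C (fun q => q.1.1).
    exact/internal_fst_of/internal_fst.
  have h2 : @internal_fun M state (naturals M) (fun q => q.1.2).
    exact/internal_snd_of/internal_fst.
  apply: (internal_pair (B := prod_ctype C (naturals M)) (C := zcoded G)).
    apply: (internal_pair (B := C) (C := naturals M)) => //.
    exact: internal_comp h2 internal_hnatS.
  apply: internal_add; first exact: internal_snd.
  exact: (internal_comp2 h1 h2 hg).
have [it [hit it0 itS]] := internal_iterate ht.
have h0 : @internal_fun M (prod_ctype C (naturals M)) state
    (fun p => ((p.1, hnat0), 0 : G)).
  apply: (internal_pair (B := prod_ctype C (naturals M)) (C := zcoded G)).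
    apply: (internal_pair (B := C) (C := naturals M)).
      exact: internal_fst.
    exact: internal_cst.
  exact: internal_cst.
exists (fun c k => (it ((c, hnat0), 0) k).2); split=> [|c|c i].
- apply/internal_snd_of; apply: (internal_comp2 h0 _ hit).
  exact: internal_snd.
- by rewrite it0.
- have itE k : (it (c, hnat0, 0) k).1 = (c, k).
    move: k; apply: internal_nat_ind => [||k IH].
    + apply: (internal_pred_eq (B := prod_ctype C (naturals M))).
        apply/internal_fst_of.
        apply: (internal_comp2 (B := state) _ _ hit); first exact: internal_cst.
        exact: internal_id.
      apply: (internal_pair (B := C) (C := naturals M)); first exact: internal_cst.
      exact: internal_id.
    + by rewrite it0.
    + by rewrite itS /t IH.
  by rewrite itS /t /= itE gE.
Qed.

End PartialSums.

Section HyperfiniteSum.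
Variable n : naturals M.
Implicit Types h : elements (sval n) -> G.

Lemma seq_sumE h v : seq_sum h v <-> exists s : naturals M -> G,
  [/\ @internal_fun M (naturals M) (zcoded G) s, s hnat0 = 0,
      forall i : elements (sval n), s (hnatS (elt_nat i)) = s (elt_nat i) + h i
    & s n = v].
Proof.
split=> -[s [s1 s2 s3 s4]]; exists s; split=> //.
- exact/s2/hnat0P.
- by move=> i; apply: s3 => //; apply/hnatSP.
- by move=> z /hnat0P->.
- move=> i j k ji /hnatSP->.
  have -> : j = elt_nat i by exact: sval_injective.
  exact: s3.
Qed.

Lemma seq_sum_uniq h v w : seq_sum h v -> seq_sum h w -> v = w.
Proof.
move=> /seq_sumE[s [si s0 sS <-]] /seq_sumE[r [ri r0 rS <-]].
(* The recurrences hold below [n] only, which confines the induction to indices up to [n].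
   Internality of [s] and [r] is what allows it. *)
suff H k : elt (sval k) (sval n) \/ k = n -> s k = r k by apply: H; right.
move: k; apply: internal_nat_ind => [||k IH kn].
- apply: internal_pred_imp; last exact: (internal_pred_eq si ri).
  apply: internal_pred_or; first exact: internal_nat_lt.
  exact: (internal_pred_eq internal_id (internal_cst n)).
- by rewrite s0 r0.
- have kn' : elt (sval k) (sval n).
    have kS : elt (sval k) (sval (hnatS k)) by apply/elt_suc; right.
    by case: kn => [h'|<-//]; apply: ist_nat_trans h' kS; exact: (svalP n).
  pose i : elements (sval n) := exist (fun x => elt x (sval n)) (sval k) kn'.
  have ik : elt_nat i = k by exact: sval_injective.
  by rewrite -ik sS rS ik IH//; left.
Qed.

(** The sum in the order of the indices, to which [hsumE] reduces [hsum]. On internal families a sum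
    exists, by [hyper_sum_seq_sum], so the default 0 does not intervene. *)
Definition hyper_sum h : G := xget 0 [set v | seq_sum h v].

Lemma seq_sum_hyper_sum h v : seq_sum h v -> hyper_sum h = v.
Proof.
move=> hv; rewrite /hyper_sum; case: xgetP => [w _ hw|/(_ v)//].
exact: seq_sum_uniq hw hv.
Qed.

Lemma hyper_sum_seq_sum h :
  @internal_fun M (elements (sval n)) (zcoded G) h -> seq_sum h (hyper_sum h).
Proof.
move=> ih.
(* The family is constant in a parameter whose type, here [naturals M], is an arbitrary choice; the
   partial sums at the parameter [hnat0] are kept. *)
have [|s [si s0 sS]] := @partial_sums (naturals M) _ n (fun=> h).
  exact: (internal_comp internal_snd ih).
have hs : seq_sum h (s hnat0 n).
  apply/seq_sumE; exists (s hnat0); split=> //.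
  apply: (internal_comp2 (B := naturals M) (C := naturals M) _ _ si).
    exact: internal_cst.
  exact: internal_id.
by rewrite (seq_sum_hyper_sum hs).
Qed.

Lemma hyper_sum_add h h' :
  @internal_fun M (elements (sval n)) (zcoded G) h ->
  @internal_fun M (elements (sval n)) (zcoded G) h' ->
  hyper_sum (fun i => h i + h' i) = hyper_sum h + hyper_sum h'.
Proof.
move=> /hyper_sum_seq_sum/seq_sumE[s [si s0 sS sn]].
move=> /hyper_sum_seq_sum/seq_sumE[r [ri r0 rS rn]].
apply: seq_sum_hyper_sum; apply/seq_sumE.
exists (fun k => s k + r k); split.
- exact: internal_add.
- by rewrite s0 r0 addr0.
- by move=> i; rewrite sS rS addrACA.
- by rewrite sn rn.
Qed.

Lemma hyper_sum0 : hyper_sum (fun=> 0) = 0.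
Proof.
apply: seq_sum_hyper_sum; apply/seq_sumE; exists (fun=> 0); split=> //.
  exact: internal_cst.
by rewrite addr0.
Qed.

Lemma hyper_sum_single h i0 :
  (forall i, i <> i0 -> h i = 0) -> hyper_sum h = h i0.
Proof.
move=> h0; apply: seq_sum_hyper_sum; apply/seq_sumE.
(* The sum of the terms below [k] is [h i0] once [i0] is below [k], and 0 before. *)
exists (fun k => if `[< elt (sval i0) (sval k) >] then h i0 else 0); split.
- apply: (internal_if (B := zcoded G)); last exact: internal_cst.
    exact: (internal_nat_gt (elt_nat i0)).
  exact: internal_cst.
- by case: asboolP => // /((hnat0P hnat0).2 erefl).
- move=> i; case: asboolP => [/elt_suc|] h1; case: asboolP => h2.
  + rewrite (h0 i) ?addr0// => e; subst i; exact: elt_irr h2.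
  + case: h1 => // e; rewrite add0r.
    by have -> : i = i0 by exact: sval_injective.
  + by case: h1; apply/elt_suc; left.
  + rewrite (h0 i) ?addr0// => e; subst i.
    by apply: h1; apply/elt_suc; right.
- by case: asboolP => // -[]; exact: (svalP i0).
Qed.

End HyperfiniteSum.

End Sums.

(** * Exchange of summations and independence of the enumeration *)

Section DoubleSums.
Context {M : set_structure} {HM : internal_set_theory M}.
Variable G : internal_zmod M.
Local Open Scope ring_scope.

(** The partial sums are internal jointly in [c] and the index; fixing the index at [n] gives the
    sums. *)
Lemma hyper_sum_internal (C : coded_type M) (cC : coding C) (n : naturals M)
    (f : C -> elements (sval n) -> G) :
  @internal_fun M (prod_ctype C (elements (sval n))) (zcoded G)
    (fun p => f p.1 p.2) ->
  @internal_fun M C (zcoded G) (fun c => hyper_sum (f c)).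
Proof.
move=> hf; have [s [si s0 sS]] := partial_sums hf.
have -> : (fun c => hyper_sum (f c)) = (fun c => s c n).
  apply: funext => c; apply: seq_sum_hyper_sum; apply/seq_sumE.
  exists (s c); split=> //.
  apply: (internal_comp2 (B := C) (C := naturals M) _ _ si).
    exact: internal_cst.
  exact: internal_id.
apply: (internal_comp2 (B := C) (C := naturals M) _ _ si).
  exact: internal_id.
exact: internal_cst.
Qed.

(** With [s i k] the partial sum of row [i], additivity shows that k |-> sum_i s i k satisfies the
    recurrence for the partial sums of the column sums; uniqueness concludes without a double
    induction. *)
Lemma hyper_sum_exchange (m n : naturals M)
    (f : elements (sval m) -> elements (sval n) -> G) :
  @internal_fun M (prod_ctype (elements (sval m)) (elements (sval n)))
    (zcoded G) (fun p => f p.1 p.2) ->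
  hyper_sum (fun i => hyper_sum (f i)) =
  hyper_sum (fun j => hyper_sum (fun i => f i j)).
Proof.
move=> hf; have [s [si s0 sS]] := partial_sums hf.
have slice k : @internal_fun M (elements (sval m)) (zcoded G) (fun i => s i k).
  apply: (internal_comp2 (B := elements (sval m)) (C := naturals M) _ _ si).
    exact: internal_id.
  exact: internal_cst.
have slicef j : @internal_fun M (elements (sval m)) (zcoded G) (fun i => f i j).
  apply: (internal_comp2 (B := elements (sval m)) (C := elements (sval n)) _ _ hf).
    exact: internal_id.
  exact: internal_cst.
apply/esym/seq_sum_hyper_sum; apply/seq_sumE.
exists (fun k => hyper_sum (fun i => s i k)); split.
- apply: (@hyper_sum_internal (naturals M)).
  apply: (internal_comp2 (B := elements (sval m)) (C := naturals M) _ _ si).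
    exact: internal_snd.
  exact: internal_fst.
- by rewrite -[RHS](@hyper_sum0 _ _ G m); congr hyper_sum; apply: funext.
- move=> j; rewrite -hyper_sum_add//; congr hyper_sum.
  by apply: funext => i; rewrite sS.
- congr hyper_sum; apply: funext => i; apply/esym/seq_sum_hyper_sum.
  apply/seq_sumE; exists (s i); split=> //.
  apply: (internal_comp2 (B := elements (sval m)) (C := naturals M) _ _ si).
    exact: internal_cst.
  exact: internal_id.
Qed.

Section Enumerations.
Context {A : coded_type M} {cA : coding A}.

(** An index for [a] is demanded only when [v <> 0]: the enumerations in [is_hsum] cover supports,
    not the whole type. *)
Lemma hyper_sum_delta (m : naturals M) (e : elements (sval m) -> A) a (v : G) :
  injective e -> (v <> 0 -> exists j, e j = a) ->
  hyper_sum (fun j => if `[< e j = a >] then v else 0) = v.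
Proof.
move=> ie hv; have [[j ej]|na] := pselect (exists j, e j = a).
  rewrite (@hyper_sum_single _ _ _ _ _ j) => [|i ij].
    by case: asboolP.
  by case: asboolP => // ei; case: ij; apply: ie; rewrite ei.
have -> : v = 0 by apply: contrapT => /hv.
by rewrite -[RHS](@hyper_sum0 _ _ G m); congr hyper_sum; apply: funext => j;
  case: ifP.
Qed.

(** Both sides sum [h i] over the pairs (l, i) with [e l = pi i] and [phi (e l)], in the two orders
    of summation: as [e] is injective, each [i] with [h i <> 0] meets exactly one [l] with
    [e l = pi i]. It serves for formal sums, for faces and for changes of enumeration. *)
Lemma hyper_sum_fibers (m n : naturals M) (e : elements (sval m) -> A)
    (pi : elements (sval n) -> A) (h : elements (sval n) -> G)
    (phi : A -> Prop) :
  internal_fun e -> injective e -> internal_fun pi ->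
  @internal_fun M (elements (sval n)) (zcoded G) h -> internal_pred phi ->
  (forall i, h i <> 0 -> exists l, e l = pi i) ->
  hyper_sum (fun l => if `[< phi (e l) >] then
    hyper_sum (fun i => if `[< pi i = e l >] then h i else 0) else 0) =
  hyper_sum (fun i => if `[< phi (pi i) >] then h i else 0).
Proof.
move=> he ie hpi hh hphi cov.
pose f l i : G := if `[< phi (e l) /\ pi i = e l >] then h i else 0.
transitivity (hyper_sum (fun l => hyper_sum (f l))).
  congr hyper_sum; apply: funext => l; case: asboolP => hl.
    congr hyper_sum; apply: funext => i; rewrite /f.
    by do 2![case: asboolP] => //; tauto.
  rewrite -[LHS](@hyper_sum0 _ _ G n); congr hyper_sum; apply: funext => i.
  by rewrite /f; case: asboolP => // -[].
rewrite hyper_sum_exchange; last first.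
  apply: (internal_if (B := zcoded G)); last exact: internal_cst.
    apply: internal_pred_and.
      exact: internal_pred_comp (internal_comp internal_fst he) hphi.
    apply: (internal_pred_eq (B := A)).
      exact: (internal_comp internal_snd hpi).
    exact: (internal_comp internal_fst he).
  exact: (internal_comp internal_snd hh).
congr hyper_sum; apply: funext => i.
rewrite -[RHS](@hyper_sum_delta _ e (pi i)) //.
  congr hyper_sum; apply: funext => l; rewrite /f.
  case: (asboolP (e l = pi i)) => [->|ne]; case: asboolP => //.
  - by move=> [h1 _]; case: asboolP.
  - by move=> h1; case: asboolP => // h2; case: h1.
  - by move=> [_ h1]; case: ne.
by case: asboolP => // _; exact: cov.
Qed.

Lemma internal_enumeration (n : naturals M) (f f' : elements (sval n) -> A) :
  internal_fun f -> internal_fun f' ->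
  exists (m : naturals M) (e : elements (sval m) -> A),
    [/\ internal_fun e, injective e,
        forall i, exists l, e l = f i & forall i, exists l, e l = f' i].
Proof.
move=> /internal_funE[F hF] /internal_funE[F' hF'].
have [SA hA] := code_set (A := A).
have tot (g : elements (sval n) -> A) K :
    (forall p, elt p K <-> exists t, p = pr (code t) (code (g t))) ->
    forall i, elt i (sval n) -> exists2 a, elt a SA & app K i a.
  move=> hK i hi.
  pose i' : elements (sval n) := exist (fun x => elt x (sval n)) i hi.
  exists (code (g i')); first by apply/hA; exists (g i').
  by apply/appE/hK; exists i'.
have fct (g : elements (sval n) -> A) K :
    (forall p, elt p K <-> exists t, p = pr (code t) (code (g t))) ->
    forall i a b, app K i a -> app K i b -> a = b.
  move=> hK i a b /appE/hK[t /pr_inj[-> ->]] /appE/hK[u /pr_inj[tu ->]].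
  by congr (code (g _)); exact: sval_injective.
have [m [E [nm [E1 E2 E3 E4] E5]]] := ist_enumeration (svalP n)
  (tot _ _ hF) (tot _ _ hF') (fct _ _ hF) (fct _ _ hF').
have /choice[e he] (l : elements m) : exists a, app E (sval l) (code a).
  have [x lx] := E2 _ (svalP l).
  move: (lx) => /appE/E1[l' [a [/prP/pr_inj[_ xa] _ /hA[b ab]]]].
  by exists b; rewrite -ab -xa.
have eE l b : app E (sval l) (code b) -> e l = b.
  by move=> h; apply: code_inj; exact: E3 (he l) h.
have cover (i : elements (sval n)) x : app F (sval i) x \/ app F' (sval i) x ->
    exists l : elements m, app E (sval l) x.
  move=> h; have [l lx] := E5 _ _ (svalP i) h.
  move: (lx) => /appE/E1[l' [a [/prP/pr_inj[<- _] lm _]]].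
  by exists (exist (fun x => elt x m) l lm).
exists (exist _ m nm), e; split.
- apply/internal_funE; exists E => p; split=> [/[dup] pE /E1|[l ->]].
    case=> l [a [/prP ep lm /hA[b eb]]]; subst p a.
    exists (exist (fun x => elt x m) l lm).
    by rewrite (eE (exist (fun x => elt x m) l lm) b)//; apply/appE.
  by apply/appE; exact: he.
- move=> l l' ll; apply: sval_injective; apply: E4 (he l) _.
  by rewrite ll; exact: he.
- move=> i; have [|l hl] := cover i (code (f i)).
    by left; apply/appE/hF; exists i.
  by exists l; exact: eE.
- move=> i; have [|l hl] := cover i (code (f' i)).
    by right; apply/appE/hF'; exists i.
  by exists l; exact: eE.
Qed.

Lemma hsumE (m : naturals M) (e : elements (sval m) -> A) (c : A -> G) :
  internal_fun e -> injective e -> @internal_fun M A (zcoded G) c ->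
  (forall a, c a <> 0 -> exists l, e l = a) ->
  hsum c = hyper_sum (fun l => c (e l)).
Proof.
move=> he ie hc cov.
(* Another enumeration [e'] gives the same sum: group the terms [c (e' i)]
   according to the index [l] with [e l = e' i]. *)
have hs : is_hsum c (hyper_sum (fun l => c (e l))).
  exists m, e; split=> //; apply: hyper_sum_seq_sum.
  exact: (internal_comp he hc).
rewrite /hsum; case: xgetP => [w _ [n [e' [he' ie' cov' hw]]]|/(_ _ hs)//].
rewrite -(seq_sum_hyper_sum hw).
have T (b b' : G) : (if `[< True >] then b else b') = b by case: asboolP.
transitivity (hyper_sum (fun i => if `[< True >] then c (e' i) else 0)).
  by congr hyper_sum; apply: funext => i; rewrite T.
have ih : @internal_fun M (elements (sval n)) (zcoded G) (fun i => c (e' i)).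
  exact: (internal_comp he' hc).
rewrite -(hyper_sum_fibers he ie he' ih (internal_pred_cst True)); last first.
  by move=> i; exact: cov.
congr hyper_sum; apply: funext => l.
rewrite T -[RHS](@hyper_sum_delta _ e' (e l)) //; last exact: cov'.
by congr hyper_sum; apply: funext => i; case: asboolP => // ->.
Qed.

End Enumerations.

End DoubleSums.

(** * Chains *)

Section Lists.
Context {M : set_structure} {HM : internal_set_theory M}.

Fixpoint list_code (s : seq M) : M :=
  if s is a :: s' then pr a (list_code s') else sval hnat0.

Lemma is_listP s p : is_list s p <-> p = list_code s.
Proof.
elim: s p => [|a s IH] p /=.
  split=> [h|->]; last exact: (hnat0P hnat0).2.
  by apply: empty_uniq h _; exact: (hnat0P hnat0).2.
split=> [[q /IH-> /prP]//|->].
by exists (list_code s); [exact/IH|exact: is_pair_pr].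
Qed.

Lemma list_code_inj s t :
  size s = size t -> list_code s = list_code t -> s = t.
Proof.
elim: s t => [|a s IH] [|b t] //= [st] /pr_inj[-> e].
by rewrite (IH t).
Qed.

(** Iterated products ending in the singleton of the empty set; [k] is a standard natural, so the
    induction is external. *)
Lemma list_code_set (S : M) k : exists L, forall u,
  elt u L <-> exists t : k.-tuple (elements S),
    u = list_code [seq sval a | a <- t].
Proof.
elim: k => [|k [L hL]].
  have [L hL] := bst_pairing (sval hnat0) (sval hnat0).
  exists L => u; rewrite (hL u); split=> [[]->|[t ->]]; try by exists [tuple].
  by left; rewrite tuple0.
have [P hP] := ist_prod S L; exists P => u; rewrite hP; split.
  case=> x [y [xS /hL[t ->] /prP->]].
  by exists [tuple of (exist (fun z => elt z S) x xS : elements S) :: t].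
case=> t ->; rewrite (tuple_eta t) /=.
exists (sval (thead t)), (list_code [seq sval a | a <- behead t]).
split; [exact: (svalP (thead t))| |exact: is_pair_pr].
by apply/hL; exists [tuple of behead t].
Qed.

End Lists.

(** * Simplices, faces and formal sums as internal objects *)

Section Simplices.
Variables (U : set_structure) (V : nonstandard_extension U).
Context {HM : internal_set_theory V}.
Variable X : standard_space U.
Implicit Types p : nat.

#[export] Instance starX_coding : coding (starX V X) := elements_coding _.

#[export, program] Instance simplex_coding p : coding (simplex V X p) :=
  { code := fun s : simplex V X p => list_code [seq sval a | a <- s] }.
Next Obligation. by move=> p t x; exact: is_listP. Qed.
Next Obligation.
move=> p s t /list_code_inj; rewrite !size_map !size_tuple => /(_ erefl).
by move=> /inj_map h; apply: val_inj; apply: h; exact: sval_injective.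
Qed.
Next Obligation. by move=> p; exact: list_code_set. Qed.

Definition first_vertex p (s : simplex V X p) : starX V X := tnth s ord0.

Lemma internal_first_vertex p : internal_fun (@first_vertex p).
Proof.
apply: internal_left_component => s.
exists (list_code [seq sval a | a <- behead s]).
by rewrite /= {1}(tuple_eta s).
Qed.

Definition vertex (a : starX V X) : simplex V X 0 := [tuple a].

Lemma first_vertexK s : vertex (first_vertex s) = s.
Proof. by apply: eq_from_tnth => i; rewrite (ord1 i). Qed.

(** Its graph is the converse of the graph of [first_vertex] on 0-simplices. *)
Lemma internal_vertex : internal_fun vertex.
Proof.
apply/internal_graph.
refine (eq_internal_pred _ (internal_pred_eq (B := starX V X)
  (internal_comp internal_snd (@internal_first_vertex 0)) internal_fst)).
by move=> [a s] /=; split=> [<-|<-//]; rewrite first_vertexK.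
Qed.

Definition last_face (s : simplex V X 1) : simplex V X 0 := [tuple of behead s].

Lemma face0E : face ord0 = last_face.
Proof.
apply: funext => s; apply: eq_from_tnth => i.
rewrite tnth_mktuple (ord1 i) tnth_behead; congr tnth.
by apply: val_inj; rewrite /= inordK.
Qed.

Lemma face1E : face (lift ord0 ord0) =
  (fun s : simplex V X 1 => vertex (first_vertex s)).
Proof.
apply: funext => s; apply: eq_from_tnth => i.
rewrite tnth_mktuple (ord1 i); congr tnth.
by apply: val_inj.
Qed.

(** An edge has two faces only: deleting vertex 0 leaves the tail of the code, deleting vertex 1
    leaves the head, and both are read off nested pairs. *)
Lemma internal_face j : internal_fun (@face _ V X 0 j).
Proof.
have [->|->] : j = ord0 \/ j = lift ord0 ord0.
  by case: j => -[|[|//]] h; [left|right]; exact: val_inj.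
  rewrite face0E; apply: internal_right_component => s.
  by exists (sval (first_vertex s)); rewrite /= {1}(tuple_eta s).
rewrite face1E.
exact: (internal_comp (@internal_first_vertex 1) internal_vertex).
Qed.

Section Chains.
Variable G : internal_zmod V.
Local Open Scope ring_scope.

Section FormalSum.
Variables (p : nat) (n : naturals V) (g : elements (sval n) -> G).
Variable s : elements (sval n) -> simplex V X p.
Hypothesis ig : @internal_fun V (elements (sval n)) (zcoded G) g.
Hypothesis is_ : @internal_fun V (elements (sval n)) (simplex V X p) s.

(** The index type enumerates itself, by the identity. *)
Lemma formal_sumE t : formal_sum g s t =
  hyper_sum (fun i => if `[< s i = t >] then g i else 0).
Proof.
apply: (@hsumE _ _ G (elements (sval n)) _ n (fun i => i)) => //.
- exact: internal_id.
- apply: (internal_if (B := zcoded G)) => //; last exact: internal_cst.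
  by apply: (internal_pred_eq (B := simplex V X p)) => //; exact: internal_cst.
- by move=> i _; exists i.
Qed.

Lemma internal_formal_sum :
  @internal_fun V (simplex V X p) (zcoded G) (formal_sum g s).
Proof.
rewrite (funext formal_sumE).
apply: (@hyper_sum_internal _ _ G (simplex V X p)).
apply: (internal_if (B := zcoded G)); last exact: internal_cst.
  apply: (internal_pred_eq (B := simplex V X p)); last exact: internal_fst.
  exact: (internal_comp internal_snd is_).
exact: (internal_comp internal_snd ig).
Qed.

Lemma hsum_formal_sum (phi : simplex V X p -> Prop) : internal_pred phi ->
  hsum (fun t => if `[< phi t >] then formal_sum g s t else 0) =
  hyper_sum (fun i => if `[< phi (s i) >] then g i else 0).
Proof.
move=> hphi.
(* [s] may repeat simplices, so its range is enumerated afresh; the joint enumeration is applied to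
   [s] twice. *)
have [m [e [he ie cov _]]] := internal_enumeration is_ is_.
rewrite (hsumE he ie).
- rewrite -(hyper_sum_fibers he ie is_ ig hphi) //.
  by congr hyper_sum; apply: funext => l; rewrite formal_sumE.
- apply: (internal_if (B := zcoded G)) => //; last exact: internal_cst.
  exact: internal_formal_sum.
- move=> t; case: asboolP => // _; rewrite formal_sumE => h.
  have [[i <-]|no] := pselect (exists i, s i = t); first exact: cov.
  case: h; rewrite -[RHS](@hyper_sum0 _ _ G n); congr hyper_sum.
  by apply: funext => i; case: asboolP => // e'; case: no; exists i.
Qed.

End FormalSum.

Lemma boundaryE (n : naturals V) (g : elements (sval n) -> G)
    (s : elements (sval n) -> simplex V X 1) :
  @internal_fun V (elements (sval n)) (zcoded G) g ->
  @internal_fun V (elements (sval n)) (simplex V X 1) s ->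
  forall t, boundary (formal_sum g s) t =
    hyper_sum (fun i => if `[< face ord0 (s i) = t >] then g i else 0) -
    hyper_sum (fun i => if `[< face (lift ord0 ord0) (s i) = t >] then g i else 0).
Proof.
move=> ig si t; rewrite /boundary 2!big_ord_recl big_ord0 addr0.
have hf j : internal_pred (fun x : simplex V X 1 => face j x = t).
  apply: (internal_pred_eq (B := simplex V X 0)); last exact: internal_cst.
  exact: internal_face.
rewrite !(hsum_formal_sum ig si) // expr0 mulr1z expr1.
Qed.

Lemma augmentation_formal_sum (n : naturals V) (g : elements (sval n) -> G)
    (s : elements (sval n) -> simplex V X 0) :
  @internal_fun V (elements (sval n)) (zcoded G) g ->
  @internal_fun V (elements (sval n)) (simplex V X 0) s ->
  augmentation (formal_sum g s) = hyper_sum g.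
Proof.
move=> ig si.
have T (b b' : G) : (if `[< True >] then b else b') = b by case: asboolP.
(* The augmentation is the case of the constantly true predicate. *)
transitivity (hsum (fun t => if `[< True >] then formal_sum g s t else 0)).
  by congr hsum; apply: funext => t; rewrite T.
rewrite (hsum_formal_sum ig si); last exact: internal_pred_cst.
by congr hyper_sum; apply: funext => t; rewrite T.
Qed.

End Chains.
End Simplices.

(** * Sums of length two *)

Section TwoTerms.
Context {M : set_structure} {HM : internal_set_theory M}.

Definition hnat2 : naturals M := hnatS (hnatS hnat0).

Lemma elt0_hnat2 : elt (sval (hnat0 : naturals M)) (sval hnat2).
Proof. by apply/elt_suc; left; apply/elt_suc; right. Qed.

Lemma elt1_hnat2 : elt (sval (hnatS hnat0 : naturals M)) (sval hnat2).
Proof. by apply/elt_suc; right. Qed.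

Definition index0 : elements (sval hnat2) :=
  exist (fun x => elt x (sval hnat2)) _ elt0_hnat2.
Definition index1 : elements (sval hnat2) :=
  exist (fun x => elt x (sval hnat2)) _ elt1_hnat2.

Lemma index1_neq0 : index1 <> index0.
Proof.
move=> /(congr1 sval) e.
have : is_empty (sval index0) by exact: (hnat0P hnat0).2.
by rewrite -e => /suc_nempty.
Qed.

Lemma hyper_sum2 (G : internal_zmod M) (h : elements (sval hnat2) -> G) :
  @internal_fun M (elements (sval hnat2)) (zcoded G) h ->
  hyper_sum h = (h index0 + h index1)%R.
Proof.
move=> /hyper_sum_seq_sum/seq_sumE[s [_ s0 sS <-]].
have e0 : elt_nat index0 = hnat0 by exact: sval_injective.
have e1 : elt_nat index1 = hnatS hnat0 by exact: sval_injective.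
by rewrite {1}/hnat2 -e1 sS e1 -e0 sS e0 s0 add0r.
Qed.

End TwoTerms.

(** * Infinite closeness and the set of reachable points *)

Section Reachability.
Variables (U : set_structure) (HU : standard_universe U).
Variables (V : nonstandard_extension U) (X : standard_space U).
Context {HM : internal_set_theory V}.

Lemma relation_code_ex (E : set (X * X)) : exists e, relation_code E e.
Proof.
have [P hP] := std_prod HU (space_code X) (space_code X).
have [e he] := su_separation HU P (fun p =>
  exists x y : X, E (x, y) /\ is_pair p (point_code x) (point_code y)).
exists e => p; rewrite he; split=> [[]//|h]; split=> //.
case: h => x [y [_ hp]]; apply/hP; exists (point_code x), (point_code y).
by split=> //; apply/space_codeP; [exists x|exists y].
Qed.

(** The inclusion of the diagonal in [E] is transferred. This makes 0-simplices and degenerate edges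
    microsimplices. *)
Lemma infinitely_close_refl (a : starX V X) : infinitely_close a a.
Proof.
move=> E hE; have [e he] := relation_code_ex E.
exists e, (pr (sval a) (sval a)); split=> //; first exact: is_pair_pr.
have := @transfer2 U V (fun M S e => forall a p, elt a S -> is_pair p a a ->
  elt p e) (space_code X) e.
move=> /(_ ltac:(by definability 2)); apply; last exact: is_pair_pr.
  move=> u p /space_codeP[x <-] hp; apply/he; exists x, x; split=> //.
  exact: entourage_refl.
exact: (svalP a).
Qed.

Section Reachable.
Variables (E : set (X * X)) (x : X).

Inductive reachable : X -> Prop :=
| reachable0 : reachable x
| reachableS y z of reachable y & E (y, z) : reachable z.

Lemma reachable_chain y : reachable y -> exists (n : nat) (s : nat -> X),
  [/\ s 0%N = x, s n = y & forall i, (i < n)%N -> E (s i, s i.+1)].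
Proof.
elim=> [|{}y z _ [n [s [s0 sn sS]]] yz]; first by exists 0%N, (fun=> x).
exists n.+1, (fun i => if (i <= n)%N then s i else z); split=> //.
  by rewrite ltnn.
move=> i; rewrite ltnS => i_n; rewrite i_n.
case: ltnP => [/sS//|n_i].
have -> : i = n by apply/eqP; rewrite eqn_leq i_n n_i.
by rewrite sn.
Qed.

(** Makes A a standard object: [reachable] is an inductive predicate of the ambient logic, and
    separation for arbitrary predicates gives it a code to which [star] applies. *)
Lemma reachable_code : exists r : U,
  forall y, elt (point_code y) r <-> reachable y.
Proof.
have [r hr] := su_separation HU (space_code X)
  (fun u => exists2 y : X, point_code y = u & reachable y).
exists r => y; rewrite hr; split=> [[_ [z /point_code_inj-> //]]|h].
by split; [apply/space_codeP|]; exists y.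
Qed.

(* A reachable set is closed under steps in [E], hence by transfer its
   extension is closed under infinite closeness. *)
Lemma infinitely_close_reachable (r : U) (a b : starX V X) : entourage E ->
  (forall y, elt (point_code y) r <-> reachable y) ->
  infinitely_close a b -> elt (sval a) (star V r) -> elt (sval b) (star V r).
Proof.
move=> hE hr /(_ E hE)[e [p [he hp pe]]].
have := @transfer2 U V (fun M e r => forall p u v, is_pair p u v -> elt p e ->
  elt u r -> elt v r) e r.
move=> /(_ ltac:(by definability 2)); apply; last exact: pe; last exact: hp.
move=> {hp pe}p u v hp /he[y [z [yz hyz]]].
have [-> ->] := is_pair_inj (HM := standard_basic HU) hp hyz.
by move=> /hr y_; apply/hr; exact: reachableS yz.
Qed.

End Reachable.

Lemma star_elt (u v : U) : elt (star V u) (star V v) <-> elt u v.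
Proof.
have := star_elementary V (FElt 0 1) (fun i => if i == 0%N then u else v).
by move=> /= h; split=> /h.
Qed.

Definition star_point (x : X) : starX V X :=
  exist (fun a => elt a (star V (space_code X))) (star V (point_code x))
    ((star_elt _ _).2 ((space_codeP X _).2 (ex_intro _ x erefl))).

End Reachability.

(** * The dipole cycle and the obstruction to its being a boundary *)

Section ReducedHomology.
Local Open Scope ring_scope.
Local Open Scope classical_set_scope.

(** A formal sum of length two, [g] at [a] and [- g] at [b]. The coefficients stay a difference of
    two conditionals, which covers the case where the vertices coincide. *)
Lemma dipole_cycle (U : set_structure) (HU : standard_universe U)
    (V : nonstandard_extension U) (X : standard_space U)
    (G : internal_zmod V) {HM : internal_set_theory V}
    (a b : starX V X) (g : G) : exists c : chain X G 0,
  [/\ microchain c, augmentation c = 0 &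
      forall tau, c tau = (if `[< vertex a = tau >] then g else 0) -
                          (if `[< vertex b = tau >] then g else 0)].
Proof.
pose h (i : elements (sval (hnat2 (HM := HM)))) : G :=
  if `[< i = index0 >] then g else - g.
pose t (i : elements (sval (hnat2 (HM := HM)))) : simplex V X 0 :=
  if `[< i = index0 >] then vertex a else vertex b.
have i0 : internal_pred
    (fun i : elements (sval (hnat2 (HM := HM))) => i = index0).
  exact: (internal_pred_eq internal_id (internal_cst _)).
have ih : @internal_fun V (elements (sval hnat2)) (zcoded G) h.
  by apply: (internal_if (B := zcoded G)) => //; exact: internal_cst.
have it : @internal_fun V (elements (sval hnat2)) (simplex V X 0) t.
  by apply: (internal_if (B := simplex V X 0)) => //; exact: internal_cst.
have h0 : h index0 = g by rewrite /h; case: asboolP.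
have h1 : h index1 = - g by rewrite /h; case: asboolP => // /index1_neq0.
have t0 : t index0 = vertex a by rewrite /t; case: asboolP.
have t1 : t index1 = vertex b by rewrite /t; case: asboolP => // /index1_neq0.
exists (formal_sum h t); split=> [||tau].
- exists hnat2, h, t; split=> // i j k.
  by rewrite (ord1 j) (ord1 k); exact: infinitely_close_refl.
- by rewrite augmentation_formal_sum// hyper_sum2// h0 h1 subrr.
- rewrite formal_sumE// hyper_sum2; last first.
    apply: (internal_if (B := zcoded G)) => //; last exact: internal_cst.
    by apply: (internal_pred_eq (B := simplex V X 0)) => //; exact: internal_cst.
  by rewrite h0 h1 t0 t1; congr +%R; case: asboolP; rewrite ?oppr0.
Qed.

(* If both ends of every edge of a 1-chain lie on the same side of [phi], the
   sum over [phi] of the coefficients of its boundary vanishes. *)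
Lemma boundary_single_coefficient (U : set_structure)
    (V : nonstandard_extension U) (X : standard_space U)
    (G : internal_zmod V) {HM : internal_set_theory V}
    (n : naturals V) (h : elements (sval n) -> G)
    (s : elements (sval n) -> simplex V X 1)
    (phi : simplex V X 0 -> Prop) (v : simplex V X 0) (g : G) :
  @internal_fun V (elements (sval n)) (zcoded G) h ->
  @internal_fun V (elements (sval n)) (simplex V X 1) s ->
  internal_pred phi ->
  (forall i, phi (face (lift ord0 ord0) (s i)) <-> phi (face ord0 (s i))) ->
  phi v ->
  (forall tau, phi tau ->
    boundary (formal_sum h s) tau = if `[< v = tau >] then g else 0) ->
  g = 0.
Proof.
move=> ih is_ iphi phi_face phiv; set c := boundary _ => cE.
(* [S j] is the chain of the [j]-th faces. The boundary identity is kept in the additive form [cS],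
   so that [hyper_sum_add] applies to it. *)
pose S j tau :=
  hyper_sum (fun i => if `[< face j (s i) = tau >] then h i else 0).
have cS tau : c tau + S (lift ord0 ord0) tau = S ord0 tau.
  by rewrite /c boundaryE// subrK.
have iface j : internal_fun (fun i => face j (s i)).
  exact: (internal_comp is_ (@internal_face _ _ _ X j)).
(* One enumeration covers both faces of all edges, hence the supports of both [S j] and of [c]. *)
have [m [e [ie inj cov0 cov1]]] :=
  internal_enumeration (iface ord0) (iface (lift ord0 ord0)).
have cov j i : exists l, e l = face j (s i).
  have [->|->] : j = ord0 \/ j = lift ord0 ord0 => //.
  by case: j => -[|[|//]] k; [left|right]; exact: val_inj.
have restrE l : (if `[< e l = v >] then g else 0) +
    (if `[< phi (e l) >] then S (lift ord0 ord0) (e l) else 0) =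
    if `[< phi (e l) >] then S ord0 (e l) else 0.
  case: (asboolP (phi (e l))) => [hl|nl]; last first.
    by case: asboolP => [el|]; rewrite ?addr0//; case: nl; rewrite el.
  rewrite -cS cE//; congr (_ + _).
  by case: asboolP => [->|ne]; case: asboolP => // ve; case: ne.
pose T j := hyper_sum (fun i => if `[< phi (face j (s i)) >] then h i else 0).
have ST j : hyper_sum (fun l => if `[< phi (e l) >] then S j (e l) else 0) = T j.
  by apply: hyper_sum_fibers.
have T01 : T (lift ord0 ord0) = T ord0.
  congr hyper_sum; apply: funext => i.
  by rewrite (propext (phi_face i)).
have iS j : @internal_fun V (simplex V X 0) (zcoded G) (S j).
  apply: (@hyper_sum_internal _ _ G (simplex V X 0)).
  apply: (internal_if (B := zcoded G)); last exact: internal_cst.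
    apply: (internal_pred_eq (B := simplex V X 0)); last exact: internal_fst.
    exact: (internal_comp internal_snd (iface j)).
  exact: (internal_comp internal_snd ih).
(* If [v] is not enumerated it is no face of any edge, so both face coefficients at [v] vanish and
   [cE] gives [g = 0]. *)
have covv : g <> 0 -> exists l, e l = v.
  move=> g0; apply: contrapT => ncov; apply: g0.
  have S0 j : S j v = 0.
    rewrite -[RHS](@hyper_sum0 _ _ G n); congr hyper_sum; apply: funext => i.
    case: asboolP => // fv; have [l el] := cov j i.
    by case: ncov; exists l; rewrite el.
  have := cS v; rewrite !S0 addr0 cE//.
  by case: asboolP.
(* [g] is the sum of the boundary coefficients over [phi]. Adding the sum of one face turns it into
   the sum of the other, and the two agree by [T01]. *)
rewrite -(hyper_sum_delta inj covv).
apply: (@addIr _ (T (lift ord0 ord0))); rewrite add0r -{1}ST.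
rewrite -hyper_sum_add.
- by rewrite T01 -ST; congr hyper_sum; apply: funext => l.
- apply: (internal_if (B := zcoded G)); try exact: internal_cst.
  by apply: (internal_pred_eq (B := simplex V X 0)) => //; exact: internal_cst.
- apply: (internal_if (B := zcoded G)); last exact: internal_cst.
    exact: internal_pred_comp ie iphi.
  exact: (internal_comp ie (iS _)).
Qed.

(** Triviality is an equality of sets of cosets, so [c] is recovered as c + 0 in its own coset. This
    requires 0 to be a boundary: it is that of a chain with zero coefficients on the degenerate edge
    at [x]. *)
Lemma trivial_reduced_homology0_boundary (U : set_structure)
    (HU : standard_universe U) (V : nonstandard_extension U)
    (X : standard_space U) (G : internal_zmod V) {HM : internal_set_theory V}
    (x : X) (c : chain X G 0) :
  reduced_homology_trivial X G 0 -> microchain c -> augmentation c = 0 ->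
  exists (n : naturals V) (g : elements (sval n) -> G)
    (s : elements (sval n) -> simplex V X 1),
    [/\ @internal_fun V (elements (sval n)) (zcoded G) g,
        @internal_fun V (elements (sval n)) (simplex V X 1) s,
        forall i, microsimplex (s i) & c = boundary (formal_sum g s)].
Proof.
move=> H mc ac.
pose coset : set (chain X G 0) :=
  [set (fun tau => c tau + b tau) | b in @boundaries U V X G 0].
have : @reduced_homology U V X G 0 coset by exists c.
rewrite H => cosetE.
suff [b [n [g [s [h1 h2 h3 ->]]]] <-] : boundaries c by exists n, g, s.
rewrite -cosetE.
pose z : elements (sval (hnat2 (HM:=HM))) -> G := fun=> 0.
pose s (i : elements (sval (hnat2 (HM:=HM)))) : simplex V X 1 :=
  [tuple star_point V x; star_point V x].
have iz : @internal_fun V (elements (sval hnat2)) (zcoded G) z.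
  exact: internal_cst.
have is_ : @internal_fun V (elements (sval hnat2)) (simplex V X 1) s.
  exact: internal_cst.
have z0 (P : elements (sval hnat2) -> Prop) :
    hyper_sum (fun i => if `[< P i >] then z i else 0) = 0.
  rewrite -[RHS](@hyper_sum0 _ _ G hnat2); congr hyper_sum.
  by apply: funext => i; case: ifP.
exists (boundary (formal_sum z s)).
  exists (formal_sum z s) => //; exists hnat2, z, s; split=> // i j k.
  have -> : tnth (s i) j = star_point V x.
    by case: j => -[|[|//]] h.
  have -> : tnth (s i) k = star_point V x.
    by case: k => -[|[|//]] h.
  exact: infinitely_close_refl.
apply: funext => t; rewrite boundaryE//.
by rewrite !(z0 (fun i => face _ (s i) = t)) subr0 addr0.
Qed.

End ReducedHomology.

Theorem theorem9 (U : set_structure) (HU : standard_universe U)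
    (V : nonstandard_extension U) (X : standard_space U)
    (G : internal_zmod V) (HG : exists g : G, g <> 0%R) :
  reduced_homology_trivial X G 0 -> chain_connected X.
Proof.
move=> H E hE x y; apply: (reachable_chain (E := E)).
apply: contrapT => nxy; have [g g0] := HG.
pose proof (extension_internal HU V) as HM.
have [r hr] := reachable_code HU E x.
pose X0 := star_point V x; pose Y0 := star_point V y.
pose phi (tau : simplex V X 0) := elt (sval (first_vertex tau)) (star V r).
have phiX : phi (vertex X0) by apply/star_elt/hr; exact: reachable0.
have phiY : ~ phi (vertex Y0) by move=> /star_elt/hr.
have [c [mc ac cE]] := dipole_cycle HU X0 Y0 g.
have [n [h [s [ih is_ ms cb]]]] :=
  trivial_reduced_homology0_boundary HU x H mc ac.
apply: g0; apply: (boundary_single_coefficient (phi := phi) ih is_ _ _ phiX).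
- apply: (internal_pred_comp (B := starX V X)
    (P := fun a => elt (sval a) (star V r)) (@internal_first_vertex _ _ _ X 0)).
  exact: internal_pred_elt.
(* [E] is not assumed symmetric; closeness of the vertices in both orders gives the two
   implications. *)
- move=> i; rewrite /phi /first_vertex !tnth_mktuple.
  by split; apply: (infinitely_close_reachable _ hE hr (ms i _ _)).
(* Within the extension of A only the term at [X0] survives, since [Y0] lies outside it. *)
- move=> tau phit; rewrite -cb cE.
  case: (asboolP (vertex Y0 = tau)) => [eY|_]; last by rewrite subr0.
  by case: phiY; rewrite eY.
Qed.
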